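(* Let $\{G(n)\}$ be a sequence of random intersection graphs with $\mathbb E\,Y(n)=\Theta(1)$ and $\mathrm{Var}(Y(n))=O(1)$. Then $$d_{TV}\Big(\omega'(G(n)),\ M\big(\lfloor (mn)^{1/2}\mathbb E\,Y(n)\rfloor,\ m\big)\Big)\to0 .$$
   Context: Random intersection graph: given positive integers $n,m$ and a probability measure $P$ on $\{0,1,\dots,m\}$, $G(n,m,P)$ has vertex set $V=[n]$ and attribute set $W=\{w_1,\dots,w_m\}$; independent random subsets $S_1,\dots,S_n\subseteq W$ are drawn with $\mathbb P(S_v=S)=P(|S|)/\binom{m}{|S|}$, and distinct $u,v$ are adjacent iff $S_u\cap S_v\neq\emptyset$. For a sequence $G(n)=G(n,m(n),P(n))$ with $m(n)\to\infty$, $X(n)$ has law $P(n)$ and $Y(n)=(n/m)^{1/2}X(n)$. $\omega'(G(n))=\max_{w\in W}|\{v: w\in S_v\}|$. $M(N,m)$ is the maximum number of balls in a bin after $N$ balls are thrown independently and uniformly at random into $m$ bins. $d_{TV}(\xi,\eta)=\frac12\sum_{i\ge0}|\mathbb P(\xi=i)-\mathbb P(\eta=i)|$ for nonnegative integer valued $\xi,\eta$. *)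

(* Defs.v *)
From mathcomp Require Import all_boot.
From Stdlib Require Import Reals ZArith.
Set Implicit Arguments. Unset Strict Implicit. Unset Printing Implicit Defensive.

Local Open Scope R_scope.

Definition rsum (T : finType) (F : T -> R) : R := \big[Rplus/R0]_(x : T) F x.
Definition rprod (T : finType) (F : T -> R) : R := \big[Rmult/R1]_(x : T) F x.
Definition rsumn (K : nat) (F : nat -> R) : R := \big[Rplus/R0]_(0 <= k < K) F k.

Definition is_prob_on (m : nat) (P : nat -> R) : Prop :=
  (forall k, (k <= m)%nat -> 0 <= P k) /\ rsumn m.+1 P = 1.

Definition EX (m : nat) (P : nat -> R) : R := rsumn m.+1 (fun k => INR k * P k).
Definition EX2 (m : nat) (P : nat -> R) : R := rsumn m.+1 (fun k => INR k ^ 2 * P k).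
(* Y = (n/m)^{1/2} X *)
Definition EY (n m : nat) (P : nat -> R) : R := sqrt (INR n / INR m) * EX m P.
Definition VarY (n m : nat) (P : nat -> R) : R :=
  (INR n / INR m) * (EX2 m P - (EX m P) ^ 2).

(* Configurations of G(n,m,P): S_v subset of W = 'I_m for each vertex v in 'I_n *)
Definition config (n m : nat) := {ffun 'I_n -> {set 'I_m}}.

Definition subset_prob (m : nat) (P : nat -> R) (S : {set 'I_m}) : R :=
  P #|S| / INR 'C(m, #|S|).

Definition config_prob (n m : nat) (P : nat -> R) (S : config n m) : R :=
  rprod (fun v : 'I_n => subset_prob P (S v)).

Definition omega' (n m : nat) (S : config n m) : nat :=
  \max_(w : 'I_m) #|[set v : 'I_n | w \in S v]|.

Definition omega'_pmf (n m : nat) (P : nat -> R) (i : nat) : R :=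
  rsum (fun S : config n m => if omega' S == i then config_prob P S else R0).

(* balls into bins: N balls, m bins, uniform *)
Definition max_load (N m : nat) (f : {ffun 'I_N -> 'I_m}) : nat :=
  \max_(b : 'I_m) #|[set i : 'I_N | f i == b]|.

Definition M_pmf (N m : nat) (i : nat) : R :=
  rsum (fun f : {ffun 'I_N -> 'I_m} =>
          if max_load f == i then / (INR m ^ N) else R0).

(* total variation distance of two pmfs on nat, both supported in [0, K) *)
Definition dTV_upto (K : nat) (f g : nat -> R) : R :=
  / 2 * rsumn K (fun i => Rabs (f i - g i)).

Definition nfloor (x : R) : nat := Z.to_nat (Int_part x).

(* Main.v *)
From HB Require Import structures.
From Stdlib Require Import Reals ZArith Lra Psatz.
Require Import Defs.
From mathcomp Require Import all_boot all_fingroup.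
Set Implicit Arguments. Unset Strict Implicit. Unset Printing Implicit Defensive.

(** Condition on the sizes [x_v = |S_v|], let [T] be their sum and write [M(N)] for the maximum
    load.  Whenever two integer variables [X <= Y] live on one space, the l1 distance of their
    laws is at most [2 (E Y - E X)], so it suffices to compare means along monotone couplings.

    - Deleting a uniformly random ball keeps each ball of a fullest bin with probability
      [1 - 1/N]; hence [E M(N) / N] is nonincreasing, and [M(T)], [M(N)] are close when [T - N]
      is small compared with [N / E M].
    - Throw [T] balls, [x_v] of them owned by the vertex [v], and let [A] be the maximal number
      of owners represented in a bin.  Then [A <= M(T)], and by exchangeability
      [E (M(T) - A)] is at most [E L(L-1) * sum_v x_v^2 / (T(T-1))], where [L = M(T)].
    - Complete the set of bins hit by the balls of [v] to a uniformly random set [S_v] of size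
      [x_v].  Then [A <= omega'(S)], and since the conditional mean of the load vector given [S]
      is the load vector of [S], convexity of the maximum gives [E omega'(S) <= E M(T)].
    - [E C(L,3) <= N^3 / m^2] yields [E L(L-1) = o(n)] and [E L = o(sqrt n)] when
      [N = O(sqrt (m n))].

    Chebyshev's and Markov's inequalities give [T - E T = O(sqrt m)] and [sum_v x_v^2 = O(m)]
    with probability close to one. *)

(** * Balls in bins *)

Definition load (N m : nat) (f : {ffun 'I_N -> 'I_m}) (b : 'I_m) : nat :=
  #|[set i | f i == b]|.

Lemma card_set_sum (T : finType) (p : pred T) :
  #|[set x | p x]| = \sum_x (p x : nat).
Proof. by rewrite -sum1dep_card big_mkcond; apply: eq_bigr => x _; case: (p x). Qed.

Lemma load_le_max (N m : nat) (f : {ffun 'I_N -> 'I_m}) b : load f b <= max_load f.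
Proof. exact: (leq_bigmax (F := load f)). Qed.

Lemma max_load_attained (N m : nat) (f : {ffun 'I_N -> 'I_m}) :
  0 < m -> exists b, max_load f = load f b.
Proof.
by move=> m0; case: (@eq_bigmax _ (load f)) => [|b Hb]; [rewrite card_ord | exists b].
Qed.

Definition insert_ball (N m : nat) (i : 'I_N.+1) (x : 'I_m) (g : {ffun 'I_N -> 'I_m}) :
  {ffun 'I_N.+1 -> 'I_m} := [ffun j => if unlift i j is Some k then g k else x].
Definition delete_ball (N m : nat) (i : 'I_N.+1) (f : {ffun 'I_N.+1 -> 'I_m}) :
  {ffun 'I_N -> 'I_m} := [ffun k => f (lift i k)].

Lemma insert_ballK (N m : nat) (i : 'I_N.+1) (x : 'I_m) g :
  delete_ball i (insert_ball i x g) = g.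
Proof. by apply/ffunP => k; rewrite !ffunE liftK. Qed.

Lemma load_delete_ball (N m : nat) (i : 'I_N.+1) (f : {ffun 'I_N.+1 -> 'I_m}) b :
  load f b = (f i == b) + load (delete_ball i f) b.
Proof.
rewrite /load !card_set_sum (bigD1_ord i) //=; congr addn.
by apply: eq_bigr => k _; rewrite ffunE.
Qed.

Lemma big_insert_ball (R : Type) (idx : R) (op : Monoid.com_law idx) (N m : nat)
    (i : 'I_N.+1) (F : {ffun 'I_N.+1 -> 'I_m} -> R) :
  \big[op/idx]_(f : {ffun 'I_N.+1 -> 'I_m}) F f
  = \big[op/idx]_(x : 'I_m) \big[op/idx]_(g : {ffun 'I_N -> 'I_m}) F (insert_ball i x g).
Proof.
rewrite pair_big (reindex (fun p : 'I_m * {ffun 'I_N -> 'I_m} => insert_ball i p.1 p.2)) //=.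
exists (fun f : {ffun 'I_N.+1 -> 'I_m} => (f i, delete_ball i f)) => [[x g] _|f _] /=.
  by rewrite insert_ballK ffunE unlift_none.
by apply/ffunP => j; rewrite ffunE; case: unliftP => [k|] ->; rewrite ?ffunE.
Qed.

Lemma sum_delete_ball (N m : nat) (i : 'I_N.+1) (F : {ffun 'I_N -> 'I_m} -> nat) :
  \sum_(f : {ffun 'I_N.+1 -> 'I_m}) F (delete_ball i f) = m * \sum_(g : {ffun 'I_N -> 'I_m}) F g.
Proof.
rewrite (big_insert_ball _ i) (eq_bigr (fun=> \sum_(g : {ffun 'I_N -> 'I_m}) F g)).
  by rewrite sum_nat_const card_ord.
by move=> x _; apply: eq_bigr => g _; rewrite insert_ballK.
Qed.

Lemma max_load_delete_ball (N m : nat) (i : 'I_N.+1) (f : {ffun 'I_N.+1 -> 'I_m}) :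
  max_load (delete_ball i f) <= max_load f.
Proof.
apply/bigmax_leqP => b _; apply: leq_trans (load_le_max f b).
by rewrite (load_delete_ball i f b) leq_addl.
Qed.

(** Fix a fullest bin [b] of [f]. Each of its balls is removed by exactly one of the [N.+1]
    deletions, so the loads of [b] after deletion add up to [N * load f b]. *)
Lemma sum_max_load_delete (N m : nat) (f : {ffun 'I_N.+1 -> 'I_m}) :
  N * max_load f <= \sum_i max_load (delete_ball i f).
Proof.
have m0 : 0 < m by case: m f => // f; case: (f ord0).
case: (max_load_attained f m0) => b ->.
have -> : N * load f b = \sum_i load (delete_ball i f) b.
  apply/eqP; rewrite -(eqn_add2l (load f b)) -mulSn.
  rewrite {2}/load card_set_sum -big_split /=.
  under eq_bigr do rewrite -load_delete_ball.
  by rewrite sum_nat_const card_ord.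
by apply: leq_sum => i _; apply: load_le_max.
Qed.

(** Each deletion map is [m]-to-one onto the throws of [N] balls, so averaging [sum_max_load_delete]
    compares the two means. *)
Lemma sum_max_load_succ (N m : nat) :
  N * \sum_(f : {ffun 'I_N.+1 -> 'I_m}) max_load f
    <= N.+1 * m * \sum_(g : {ffun 'I_N -> 'I_m}) max_load g.
Proof.
rewrite big_distrr /=.
rewrite (@leq_trans (\sum_(f : {ffun 'I_N.+1 -> 'I_m}) \sum_i max_load (delete_ball i f))) //.
  by apply: leq_sum => f _; apply: sum_max_load_delete.
rewrite exchange_big /=; under eq_bigr do rewrite sum_delete_ball.
by rewrite sum_nat_const card_ord mulnA.
Qed.

(** For [r > 0], an [r]-set of balls shares a bin with probability [m ^ (1 - r)]. The induction
    inserts one ball and applies Pascal's rule in the bin that it enters. *)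
Lemma sum_binom_load (r N m : nat) :
  m ^ r * \sum_(f : {ffun 'I_N -> 'I_m}) \sum_b 'C(load f b, r) = 'C(N, r) * m ^ N.+1.
Proof.
elim: N r => [|N IH] [|r].
- under eq_bigr do under eq_bigr do rewrite bin0.
  by rewrite !sum_nat_const card_ffun !card_ord bin0 !muln1 expn0 expn1 !mul1n.
- rewrite bin0n mul0n big1 ?muln0 // => f _; rewrite big1 // => b _.
  by rewrite /load card_set_sum big_ord0.
- under eq_bigr do under eq_bigr do rewrite bin0.
  by rewrite !sum_nat_const card_ffun !card_ord bin0 !muln1 expn0 !mul1n -expnSr.
- have -> : \sum_(f : {ffun 'I_N.+1 -> 'I_m}) \sum_b 'C(load f b, r.+1)
     = m * (\sum_(g : {ffun 'I_N -> 'I_m}) \sum_b 'C(load g b, r.+1))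
       + \sum_(g : {ffun 'I_N -> 'I_m}) \sum_b 'C(load g b, r).
    rewrite (big_insert_ball _ ord0) exchange_big big_distrr /= -big_split.
    apply: eq_bigr => g _ /=; rewrite exchange_big big_distrr -big_split /=.
    apply: eq_bigr => b _.
    rewrite (eq_bigr (fun x => 'C(load g b, r.+1) + (x == b) * 'C(load g b, r))) => [|x _].
      rewrite big_split /= sum_nat_const card_ord -big_distrl /= (bigD1 b) //= eqxx.
      by rewrite big1 ?mul1n // => x /negbTE ->.
    rewrite (load_delete_ball ord0) insert_ballK ffunE unlift_none.
    by case: (x == b); rewrite ?add1n ?binS ?mul1n ?mul0n ?addn0.
  by rewrite mulnDr mulnCA IH (expnS m r) -[m * _ * _]mulnA IH -mulnDr -mulnDl -binS mulnCA -expnS.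
Qed.

Lemma sum_binom_max_load (r N m : nat) : 0 < m ->
  m ^ r * \sum_(f : {ffun 'I_N -> 'I_m}) 'C(max_load f, r) <= 'C(N, r) * m ^ N.+1.
Proof.
move=> m0; rewrite -sum_binom_load leq_mul2l; apply/orP; right.
apply: leq_sum => f _; case: (max_load_attained f m0) => b ->.
by rewrite (bigD1 b) //= leq_addr.
Qed.

(** * Balls with owners *)

(** In each colour class of [B] one representative is singled out. Representatives have distinct
    colours, and any other element collides with its representative, so the double sum counts it at
    least once. *)
Lemma card_le_imset_collisions (T1 T2 : finType) (c : T1 -> T2) (B : {set T1}) :
  #|B| <= #|c @: B| + \sum_j \sum_(k | k != j) (c j == c k) * ((j \in B) * (k \in B)).
Proof.
(* For [j] in [B] the search succeeds, as [j] itself qualifies, and its outcome depends only on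
   [c j]; hence [c] is injective on the fixed points [Q]. *)
pose r j := odflt j [pick k in B | c k == c j].
have rP j : j \in B -> (r j \in B) && (c (r j) == c j).
  by move=> jB; rewrite /r; case: pickP => [k //|/(_ j)]; rewrite jB eqxx.
pose Q := [set j in B | r j == j].
have cardQ : #|Q| <= #|c @: B|.
  rewrite -(@card_in_imset _ _ c Q).
    by apply/subset_leq_card/imsetS/subsetP => j; rewrite inE => /andP[].
  move=> j k; rewrite !inE => /andP[jB /eqP rj] /andP[kB /eqP rk] cjk.
  rewrite -rj -rk /r cjk; case: pickP => // /(_ k).
  by rewrite kB eqxx.
have -> : #|B| = #|Q| + #|B :\: Q|.
  by rewrite -(cardsID Q B) (setIidPr _) //; apply/subsetP => j; rewrite inE => /andP[].
apply: leq_add => //.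
have -> : B :\: Q = [set j | (j \in B) && (r j != j)].
  by apply/setP => j; rewrite !inE; case: (j \in B); rewrite /= ?andbT.
rewrite card_set_sum; apply: leq_sum => j _; case jB: (j \in B) => //=.
case rj: (r j == j) => //=; rewrite (bigD1 (r j)) ?rj //=.
by case/andP: (rP j jB) => -> /eqP ->; rewrite eqxx.
Qed.

Definition label_load (T n m : nat) (c : 'I_T -> 'I_n) (f : {ffun 'I_T -> 'I_m}) : nat :=
  \max_(b : 'I_m) #|c @: [set j | f j == b]|.

Lemma label_load_le (T n m : nat) (c : 'I_T -> 'I_n) (f : {ffun 'I_T -> 'I_m}) :
  label_load c f <= max_load f.
Proof.
by apply/bigmax_leqP => b _; apply: leq_trans (load_le_max f b); apply: leq_imset_card.
Qed.

(* A fullest bin, chosen as a function of the load vector alone so that the choice is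
   invariant under relabelling the balls. *)
Definition top_bin (m : nat) (b0 : 'I_m) (l : {ffun 'I_m -> nat}) : 'I_m :=
  [arg max_(b > b0) l b].

Definition fullest (N m : nat) (b0 : 'I_m) (f : {ffun 'I_N -> 'I_m}) : 'I_m :=
  top_bin b0 [ffun b => load f b].

Lemma load_fullest (N m : nat) (b0 : 'I_m) (f : {ffun 'I_N -> 'I_m}) :
  load f (fullest b0 f) = max_load f.
Proof.
apply/eqP; rewrite eqn_leq load_le_max /=; apply/bigmax_leqP => b _.
rewrite /fullest /top_bin; case: arg_maxnP => // i _ /(_ b isT).
by rewrite !ffunE.
Qed.

Definition both_in_top (N m : nat) (b0 : 'I_m) (j k : 'I_N) : nat :=
  \sum_(f : {ffun 'I_N -> 'I_m}) (f j == fullest b0 f) * (f k == fullest b0 f).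

(** Composing a throw with a permutation of the balls keeps the load vector, and so the chosen
    fullest bin. *)
Lemma both_in_top_perm (N m : nat) (b0 : 'I_m) (s : {perm 'I_N}) j k :
  both_in_top b0 (s j) (s k) = both_in_top b0 j k.
Proof.
pose act (u : {perm 'I_N}) (f : {ffun 'I_N -> 'I_m}) := [ffun i => f (u i)].
rewrite [in RHS]/both_in_top (reindex (act s)) /=.
  apply: eq_bigr => f _; rewrite !ffunE.
  suff -> : fullest b0 (act s f) = fullest b0 f by [].
  congr top_bin; apply/ffunP => b; rewrite !ffunE /load.
  rewrite -[RHS](card_preimset (f := s)); last exact: perm_inj.
  by apply: eq_card => i; rewrite !inE ffunE.
by exists (act (s^-1)%g) => f _; apply/ffunP => i; rewrite !ffunE ?permK ?permKV.
Qed.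

Lemma both_in_top_const (N m : nat) (b0 : 'I_m) (j j' k k' : 'I_N) :
  j' != j -> k' != k -> both_in_top b0 j j' = both_in_top b0 k k'.
Proof.
(* [s1] carries [j] to [k]; then [s2] fixes [k] and carries [s1 j'] to [k']. *)
move=> jj kk; pose s1 := tperm j k; pose s2 := tperm (s1 j') k'.
have s1j : s1 j = k by rewrite tpermL.
have s2k : s2 k = k.
  by rewrite tpermD // -s1j (inj_eq perm_inj).
rewrite -(both_in_top_perm b0 (s1 * s2)%g) !permM s1j s2k.
by rewrite /s2 tpermL.
Qed.

Lemma sum_pairs_const (N a : nat) :
  \sum_(j < N) \sum_(k < N | k != j) a = N * N.-1 * a.
Proof.
rewrite (eq_bigr (fun=> N.-1 * a)) => [|j _]; first by rewrite sum_nat_const card_ord mulnA.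
by rewrite sum_nat_const cardC1 card_ord.
Qed.

Lemma sum_pairs_in (N : nat) (p : pred 'I_N) :
  \sum_(j < N) \sum_(k < N | k != j) p j * p k = #|[set j | p j]| * #|[set j | p j]|.-1.
Proof.
rewrite [X in X * _]card_set_sum big_distrl /=; apply: eq_bigr => j _.
rewrite -big_distrr /=; case pj: (p j) => //; congr (_ * _).
by rewrite card_set_sum [in RHS](bigD1 j) //= pj.
Qed.

(** Double counting: a throw with maximal load [L] has [L (L - 1)] ordered pairs of distinct balls
    in the chosen bin, and by exchangeability all such pairs are counted equally often. *)
Lemma both_in_top_total (N m : nat) (b0 : 'I_m) (j j' : 'I_N) : j' != j ->
  N * N.-1 * both_in_top b0 j j' =
  \sum_(f : {ffun 'I_N -> 'I_m}) max_load f * (max_load f).-1.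
Proof.
move=> jj; rewrite -sum_pairs_const.
under eq_bigr => k _ do (under eq_bigr => k' kk do rewrite (both_in_top_const b0 jj kk)).
under eq_bigr do rewrite exchange_big.
rewrite exchange_big; apply: eq_bigr => f _ /=.
by rewrite sum_pairs_in -!(load_fullest b0 f).
Qed.

Definition collisions (T n : nat) (c : 'I_T -> 'I_n) : nat :=
  \sum_j \sum_(k | k != j) (c j == c k).

(** In the fullest bin the balls exceed the owners by at most the number of ordered pairs with a
    common owner. By exchangeability each such pair lies there with probability
    [E L(L-1) / (T(T-1))]; the factor [T * T.-1] clears the denominator. *)
Lemma sum_label_load (T n m : nat) (c : 'I_T -> 'I_n) : 0 < m ->
  T * T.-1 * \sum_(f : {ffun 'I_T -> 'I_m}) max_load f
    <= T * T.-1 * (\sum_(f : {ffun 'I_T -> 'I_m}) label_load c f)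
       + collisions c * \sum_(f : {ffun 'I_T -> 'I_m}) max_load f * (max_load f).-1.
Proof.
move=> m0; pose b0 := Ordinal m0.
set D := \sum_f _ * _.-1.
have pointwise (f : {ffun 'I_T -> 'I_m}) : max_load f <= label_load c f +
    \sum_j \sum_(k | k != j)
      (c j == c k) * ((f j == fullest b0 f) * (f k == fullest b0 f)).
  rewrite -(load_fullest b0) (leq_trans (card_le_imset_collisions c _)) //.
  apply: leq_add; first exact: (leq_bigmax (F := fun b => #|c @: [set j | f j == b]|)).
  by apply: leq_sum => j _; apply: leq_sum => k _; rewrite !inE.
apply: (@leq_trans (T * T.-1 * (\sum_f (label_load c f + \sum_j \sum_(k | k != j)
      (c j == c k) * ((f j == fullest b0 f) * (f k == fullest b0 f)))))).
  by rewrite leq_mul2l leq_sum ?orbT.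
rewrite big_split mulnDr leq_add2l exchange_big /= big_distrl big_distrr /=.
apply: leq_sum => j _; rewrite exchange_big big_distrl big_distrr /=.
apply: leq_sum => k kj; rewrite -big_distrr /= mulnCA leq_mul2l.
by rewrite -/(both_in_top b0 j k) both_in_top_total // leqnn orbT.
Qed.

Lemma collisions_le (T n : nat) (c : 'I_T -> 'I_n) :
  collisions c <= \sum_v #|[set j | c j == v]| ^ 2.
Proof.
apply: (@leq_trans (\sum_j \sum_k (c j == c k))).
  by apply: leq_sum => j _; rewrite [X in _ <= X](bigD1 j) //= leq_addl.
rewrite (eq_bigr (fun j => \sum_v (c j == v) * \sum_k (c k == v))); last first.
  move=> j _; rewrite (bigD1 (c j)) //= eqxx mul1n [X in _ + X]big1 ?addn0.
    by apply: eq_bigr => k _; rewrite eq_sym.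
  by move=> v /negbTE; rewrite eq_sym => ->.
rewrite exchange_big; apply: leq_sum => v _.
by rewrite -big_distrl /= card_set_sum mulnn.
Qed.

(** The balls enumerate the disjoint union of the types ['I_(x v)], and the owner is the tag. *)
Lemma labelling_exists (n : nat) (x : 'I_n -> nat) :
  exists c : 'I_(\sum_v x v) -> 'I_n, forall v, #|[set j | c j == v]| = x v.
Proof.
pose B := {v : 'I_n & 'I_(x v)}.
have cardB : #|{: B}| = \sum_v x v.
  by rewrite card_tagged sumnE big_map big_enum; apply: eq_bigr => v _; rewrite card_ord.
rewrite -cardB; exists (fun j => tag (enum_val j)) => v.
have -> : [set j : 'I_#|{: B}| | tag (enum_val j) == v]
    = enum_val @^-1: [set b : B | tag b == v] by apply/setP => j; rewrite !inE.
rewrite on_card_preimset; last first.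
  by apply: onW_bij; exists (@enum_rank B); [exact: enum_valK|exact: enum_rankK].
rewrite -[RHS]card_ord -(card_imset _ (f := fun i => Tagged (fun v => 'I_(x v)) i)).
  apply: eq_card => -[w i]; rewrite inE; apply/eqP/imsetP => [/= e|[k _ ->] //].
  by subst w; exists i.
by move=> i k /eqP; rewrite eq_Tagged => /eqP.
Qed.

(** * Finite sums of reals and couplings *)

Local Open Scope R_scope.

(** These instances let the generic lemmas on big operators act on real sums and products, including
    [rsum], [rprod] and [rsumn], which unfold to the same operators. *)
HB.instance Definition _ := Monoid.isComLaw.Build R R0 Rplus
  (fun x y z => esym (Rplus_assoc x y z)) Rplus_comm Rplus_0_l.
HB.instance Definition _ := Monoid.isComLaw.Build R R1 Rmult
  (fun x y z => esym (Rmult_assoc x y z)) Rmult_comm Rmult_1_l.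
HB.instance Definition _ := Monoid.isMulLaw.Build R R0 Rmult Rmult_0_l Rmult_0_r.
HB.instance Definition _ := Monoid.isAddLaw.Build R Rmult Rplus
  Rmult_plus_distr_r Rmult_plus_distr_l.

Notation "\sum_ ( i <- r | P ) F" := (\big[Rplus/R0]_(i <- r | P%B) F) : R_scope.
Notation "\sum_ ( m <= i < n ) F" := (\big[Rplus/R0]_(m%N <= i < n%N) F) : R_scope.
Notation "\sum_ ( i : t ) F" := (\big[Rplus/R0]_(i : t) F) (only parsing) : R_scope.
Notation "\sum_ ( i 'in' A ) F" := (\big[Rplus/R0]_(i in A) F) : R_scope.
Notation "\sum_ i F" := (\big[Rplus/R0]_i F) : R_scope.

Lemma Rsum_ge0 (I : Type) (r : seq I) (p : pred I) (F : I -> R) :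
  (forall i, p i -> 0 <= F i) -> 0 <= \sum_(i <- r | p i) F i.
Proof.
move=> F0; elim/big_ind: _ => // [|x y]; first exact: Rle_refl.
exact: Rplus_le_le_0_compat.
Qed.

Lemma Rsum_le (I : Type) (r : seq I) (p : pred I) (F G : I -> R) : (forall i, p i -> F i <= G i) ->
  \sum_(i <- r | p i) F i <= \sum_(i <- r | p i) G i.
Proof.
move=> FG; elim/big_ind2: _ => // [|x y z t]; first exact: Rle_refl.
exact: Rplus_le_compat.
Qed.

Lemma Rsum_abs (I : Type) (r : seq I) (p : pred I) (F : I -> R) :
  Rabs (\sum_(i <- r | p i) F i) <= \sum_(i <- r | p i) Rabs (F i).
Proof.
elim/big_ind2: _ => [|x y z t xy zt|i _]; rewrite ?Rabs_R0; try exact: Rle_refl.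
by apply: Rle_trans (Rabs_triang _ _) _; apply: Rplus_le_compat.
Qed.

Lemma Rsum_opp (I : Type) (r : seq I) (p : pred I) (F : I -> R) :
  \sum_(i <- r | p i) - F i = - \sum_(i <- r | p i) F i.
Proof. by apply/esym/(big_morph Ropp Ropp_plus_distr Ropp_0). Qed.

Lemma Rsum_sub (I : Type) (r : seq I) (p : pred I) (F G : I -> R) :
  \sum_(i <- r | p i) (F i - G i) = \sum_(i <- r | p i) F i - \sum_(i <- r | p i) G i.
Proof. by rewrite big_split /= Rsum_opp. Qed.

Lemma INR_sum (I : Type) (r : seq I) (p : pred I) (F : I -> nat) :
  INR (\big[addn/0%N]_(i <- r | p i) F i) = \sum_(i <- r | p i) INR (F i).
Proof. by apply: (big_morph INR) => // x y; rewrite -plusE plus_INR. Qed.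

Lemma INR_leq a b : (a <= b)%N -> INR a <= INR b.
Proof. by move=> /leP; apply: le_INR. Qed.

Lemma INR_addn a b : INR (a + b)%N = INR a + INR b.
Proof. by rewrite -plusE plus_INR. Qed.

Lemma INR_muln a b : INR (a * b)%N = INR a * INR b.
Proof. by rewrite -multE mult_INR. Qed.

Lemma INR_expn a k : INR (a ^ k)%N = INR a ^ k.
Proof. by elim: k => // k IH; rewrite expnS INR_muln IH. Qed.

Lemma INR_gt0 a : (0 < a)%N -> 0 < INR a.
Proof. by move=> /ltP; apply: lt_0_INR. Qed.

Lemma Rsum_const (T : finType) (A : {pred T}) (a : R) : \sum_(i in A) a = INR #|A| * a.
Proof.
rewrite big_const; elim: #|A| => [|k IH]; first by rewrite Rmult_0_l.
by rewrite iterS IH S_INR Rmult_plus_distr_r Rmult_1_l Rplus_comm.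
Qed.

Lemma Rsum_constT (T : finType) (a : R) : \sum_(i : T) a = INR #|T| * a.
Proof. exact: Rsum_const. Qed.

Definition indic (b : bool) : R := if b then 1 else 0.

Lemma indic_ge0 b : 0 <= indic b. Proof. by case: b; rewrite /indic; lra. Qed.

(** An inequality, because the window [[0, K)] may miss [k]; thanks to it the later bounds hold for
    every [K]. *)
Lemma sum_indic_eq_le1 (K k : nat) : \sum_(0 <= i < K) indic (k == i) <= 1.
Proof.
rewrite big_mkord; case: (ltnP k K) => kK; last first.
  rewrite big1; first lra.
  move=> i _; rewrite /indic; case: eqP => // ki.
  by move: (ltn_ord i); rewrite -ki ltnNge kK.
rewrite (bigD1 (Ordinal kK)) //= big1 => [|i].
  by rewrite /indic eqxx; lra.
by rewrite -val_eqE /indic /= eq_sym => /negbTE ->.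
Qed.

(** Where [X t = Y t] the indicators cancel; where [X t < Y t] they contribute at most 2, while
    [Y t - X t] is at least 1. The order is asked for on the support of [w], which suits the joint
    law of a throw and its completion. *)
Lemma coupling_bound (T : finType) (w : T -> R) (X Y : T -> nat) (K : nat) :
  (forall t, 0 <= w t) -> (forall t, w t <> 0 -> (X t <= Y t)%N) ->
  \sum_(0 <= i < K) Rabs (\sum_t w t * indic (X t == i) - \sum_t w t * indic (Y t == i))
    <= 2 * \sum_t w t * (INR (Y t) - INR (X t)).
Proof.
move=> w0 XY.
apply: (Rle_trans _ (\sum_(0 <= i < K) \sum_t w t * Rabs (indic (X t == i) - indic (Y t == i)))).
  apply: Rsum_le => i _; rewrite -Rsum_sub; apply: Rle_trans (Rsum_abs _ _ _) _.
  apply: Rsum_le => t _; rewrite -Rmult_minus_distr_l Rabs_mult (Rabs_pos_eq _ (w0 t)).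
  exact: Rle_refl.
rewrite exchange_big big_distrr /=; apply: Rsum_le => t _; rewrite -big_distrr /=.
case: (Req_dec (w t) 0) => [->|wt]; first lra.
have le2 : \sum_(0 <= i < K) Rabs (indic (X t == i) - indic (Y t == i)) <= 2.
  apply: (Rle_trans _ (\sum_(0 <= i < K) (indic (X t == i) + indic (Y t == i)))).
    apply: Rsum_le => i _; apply: Rle_trans (Rabs_triang _ _) _.
    rewrite Rabs_Ropp !Rabs_pos_eq; [exact: Rle_refl|exact: indic_ge0|exact: indic_ge0].
  rewrite big_split /=.
  have := sum_indic_eq_le1 K (X t); have := sum_indic_eq_le1 K (Y t); lra.
have {wt} := XY t wt; rewrite leq_eqVlt => /orP[/eqP <-|lt].
  rewrite big1 => [|i _]; first by have := w0 t; lra.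
  by rewrite Rminus_diag Rabs_R0.
have : INR (X t) + 1 <= INR (Y t) by rewrite -S_INR; apply: INR_leq.
by have := w0 t; nra.
Qed.

Lemma card_extend_set (T : finType) (A : {set T}) k :
  (#|A| <= k <= #|T|)%N -> exists2 B : {set T}, A \subset B & #|B| = k.
Proof.
case/andP=> Ak kT; elim: k Ak kT => [|k IH] Ak kT.
  by exists A => //; apply/eqP; rewrite -leqn0.
move: Ak; rewrite leq_eqVlt => /orP[/eqP Ak|Ak]; first by exists A.
have [B AB Bk] := IH Ak (ltnW kT).
have [x xB] : exists x, x \notin B.
  apply/existsP; rewrite -negb_forall; apply: contraL kT => /forallP allB.
  by rewrite -ltnNge ltnS -Bk subset_leq_card //; apply/subsetP => x _; apply: allB.
by exists (x |: B); [exact: subset_trans AB (subsetUr _ _)|rewrite cardsU1 xB Bk].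
Qed.

(** List [T] with the members of the set first. Matching positions in the lists for [A] and [B] is a
    permutation, and it sends the initial segment [A] into [B]. *)
Lemma perm_imset_eq_card (T : finType) (A B : {set T}) :
  #|A| = #|B| -> exists s : {perm T}, s @: A = B.
Proof.
move=> cAB; pose enm (C : {set T}) := enum C ++ enum (~: C).
have memE C x : x \in enm C by rewrite mem_cat !mem_enum !inE orbN.
have uniqE C : uniq (enm C).
  rewrite cat_uniq !enum_uniq andbT /=; apply/hasPn => x.
  by rewrite !mem_enum inE.
have sizeE C : size (enm C) = #|T| by rewrite size_cat -!cardE cardsC.
pose f x := nth x (enm B) (index x (enm A)).
have idx x : (index x (enm A) < size (enm B))%N by rewrite sizeE -(sizeE A) index_mem.
have f_inj : injective f.
  move=> x y; rewrite /f (set_nth_default y x (idx x)).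
  move=> /eqP; rewrite nth_uniq // => /eqP e.
  by rewrite -(nth_index x (memE A x)) e nth_index.
exists (perm f_inj); apply/eqP; rewrite eqEcard (card_imset _ perm_inj) cAB leqnn andbT.
apply/subsetP => _ /imsetP[x xA ->]; rewrite permE /f.
have lt : (index x (enm A) < size (enum B))%N.
  by rewrite index_cat mem_enum xA -cardE -cAB cardE index_mem mem_enum.
by rewrite nth_cat lt -mem_enum mem_nth.
Qed.

(** * Random completion of the bins hit by each owner *)

Definition size_class (n m : nat) (x : 'I_n -> nat) : {set config n m} :=
  [set S : config n m | [forall v, #|S v| == x v]].

Definition fiber_card (T n : nat) (c : 'I_T -> 'I_n) (v : 'I_n) : nat :=
  #|[set j | c j == v]|.

Definition completions (T n m : nat) (c : 'I_T -> 'I_n) (f : {ffun 'I_T -> 'I_m}) :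
  {set config n m} :=
  [set S in size_class m (fiber_card c) | [forall j, f j \in S (c j)]].

(** The conditional law of the random completion given the throw [f]: uniform on
    [completions c f]. *)
Definition kernel (T n m : nat) (c : 'I_T -> 'I_n) (f : {ffun 'I_T -> 'I_m})
  (S : config n m) : R :=
  indic (S \in completions c f) / INR #|completions c f|.

Lemma completions_gt0 (T n m : nat) (c : 'I_T -> 'I_n) (f : {ffun 'I_T -> 'I_m}) :
  (forall v, fiber_card c v <= m)%N -> (0 < #|completions c f|)%N.
Proof.
move=> xm; pose img v := [set f j | j in [set j | c j == v]].
have ex v : exists B : {set 'I_m}, (img v \subset B) && (#|B| == fiber_card c v).
  have [|B iB cB] := @card_extend_set _ (img v) (fiber_card c v).
    by rewrite leq_imset_card card_ord xm.
  by exists B; rewrite iB cB eqxx.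
apply/card_gt0P; exists [ffun v => xchoose (ex v)]; rewrite !inE.
apply/andP; split; apply/forallP => v; rewrite ffunE.
  by case/andP: (xchooseP (ex v)).
case/andP: (xchooseP (ex (c v))) => /subsetP sub _; apply: sub.
by apply: imset_f; rewrite inE.
Qed.

Lemma kernel_ge0 (T n m : nat) (c : 'I_T -> 'I_n) (f : {ffun 'I_T -> 'I_m}) S :
  0 <= kernel c f S.
Proof.
rewrite /kernel; case SC: (S \in _); last by rewrite /indic /Rdiv; lra.
have : 0 < INR #|completions c f| by apply: INR_gt0; apply/card_gt0P; exists S.
by move=> C0; apply/Rlt_le/Rdiv_lt_0_compat => //; rewrite /indic; lra.
Qed.

Lemma kernel_neq0 (T n m : nat) (c : 'I_T -> 'I_n) (f : {ffun 'I_T -> 'I_m}) S :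
  kernel c f S <> 0 -> S \in completions c f.
Proof. by rewrite /kernel; case: (S \in _) => //; rewrite /indic; lra. Qed.

Lemma sum_indic_in (I : finType) (A : {set I}) (F : I -> R) :
  \sum_i indic (i \in A) * F i = \sum_(i in A) F i.
Proof.
rewrite [RHS]big_mkcond; apply: eq_bigr => i _.
by case: (i \in A); rewrite /indic; lra.
Qed.

Lemma sum_kernel (T n m : nat) (c : 'I_T -> 'I_n) (f : {ffun 'I_T -> 'I_m}) :
  (forall v, fiber_card c v <= m)%N -> \sum_S kernel c f S = 1.
Proof.
move=> xm; rewrite /kernel /Rdiv (sum_indic_in (completions c f)) Rsum_const.
by apply: Rinv_r; apply/Rgt_not_eq/INR_gt0/completions_gt0.
Qed.

(** Every owner permutes the bins on its own. The actions on throws and on configurations respect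
    completion, and this symmetry replaces explicit counting of completions. *)
Definition relabel_balls (T n m : nat) (c : 'I_T -> 'I_n) (s : {ffun 'I_n -> {perm 'I_m}})
  (f : {ffun 'I_T -> 'I_m}) : {ffun 'I_T -> 'I_m} := [ffun j => s (c j) (f j)].
Definition relabel_sets (n m : nat) (s : {ffun 'I_n -> {perm 'I_m}}) (S : config n m) :
  config n m := [ffun v => s v @: S v].

Lemma relabel_balls_bij (T n m : nat) (c : 'I_T -> 'I_n) (s : {ffun 'I_n -> {perm 'I_m}}) :
  bijective (relabel_balls c s).
Proof.
exists (relabel_balls c [ffun v => (s v)^-1%g]) => f; apply/ffunP => j; rewrite !ffunE.
  exact: permK.
exact: permKV.
Qed.

Lemma relabel_sets_inj (n m : nat) (s : {ffun 'I_n -> {perm 'I_m}}) :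
  injective (@relabel_sets n m s).
Proof.
move=> S S' /ffunP e; apply/ffunP => v; move: (e v); rewrite !ffunE.
by apply: imset_inj; apply: perm_inj.
Qed.

Lemma relabel_sets_completions (T n m : nat) (c : 'I_T -> 'I_n) s
    (f : {ffun 'I_T -> 'I_m}) (S : config n m) :
  (relabel_sets s S \in completions c (relabel_balls c s f)) = (S \in completions c f).
Proof.
rewrite !inE; congr andb; apply: eq_forallb => v.
  by rewrite ffunE card_imset //; apply: perm_inj.
by rewrite !ffunE mem_imset //; apply: perm_inj.
Qed.

Lemma card_completions_relabel (T n m : nat) (c : 'I_T -> 'I_n) s
    (f : {ffun 'I_T -> 'I_m}) :
  #|completions c (relabel_balls c s f)| = #|completions c f|.
Proof.
rewrite -(card_imset (completions c f) (@relabel_sets_inj n m s)).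
apply: eq_card => S; apply/idP/imsetP => [SC|[S0 S0C ->]]; last first.
  by rewrite relabel_sets_completions.
have K : relabel_sets s (relabel_sets [ffun v => (s v)^-1%g] S) = S.
  apply/ffunP => v; rewrite !ffunE -imset_comp -[RHS]imset_id.
  by apply: eq_imset => w /=; rewrite permKV.
exists (relabel_sets [ffun v => (s v)^-1%g] S); last by rewrite K.
by rewrite -(relabel_sets_completions _ s) K.
Qed.

Lemma kernel_relabel (T n m : nat) (c : 'I_T -> 'I_n) s (f : {ffun 'I_T -> 'I_m}) S :
  kernel c (relabel_balls c s f) (relabel_sets s S) = kernel c f S.
Proof. by rewrite /kernel card_completions_relabel relabel_sets_completions. Qed.

(** For a uniform throw followed by its random completion, this is [m ^ T] times the probability of
    [S]. *)
Definition kernel_mass (T n m : nat) (c : 'I_T -> 'I_n) (S : config n m) : R :=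
  \sum_f kernel c f S.

Lemma kernel_mass_relabel (T n m : nat) (c : 'I_T -> 'I_n) s (S : config n m) :
  kernel_mass c (relabel_sets s S) = kernel_mass c S.
Proof.
rewrite /kernel_mass (reindex (relabel_balls c s)).
  by apply: eq_bigr => f _; rewrite kernel_relabel.
exact/onW_bij/relabel_balls_bij.
Qed.

(** Owner-wise permutations act transitively on the configurations with given set sizes, so the
    completed configuration is uniform on that class. *)
Lemma kernel_mass_const (T n m : nat) (c : 'I_T -> 'I_n) (S S' : config n m) :
  S \in size_class m (fiber_card c) -> S' \in size_class m (fiber_card c) ->
  kernel_mass c S = kernel_mass c S'.
Proof.
rewrite !inE => /forallP cS /forallP cS'.
have ex v : exists s : {perm 'I_m}, s @: S v == S' v.
  have [|s e] := @perm_imset_eq_card _ (S v) (S' v); last by exists s; apply/eqP.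
  by rewrite (eqP (cS v)) (eqP (cS' v)).
rewrite -(kernel_mass_relabel c [ffun v => xchoose (ex v)] S); congr kernel_mass.
by apply/ffunP => v; rewrite !ffunE; apply/eqP/(xchooseP (ex v)).
Qed.

(** Up to normalisation, the mean number of balls of [v] in bin [w] on the event that the completion
    is [S]. *)
Definition kernel_load (T n m : nat) (c : 'I_T -> 'I_n) (S : config n m) v w : R :=
  \sum_f kernel c f S * INR #|[set j | (c j == v) && (f j == w)]|.

Lemma kernel_load_notin (T n m : nat) (c : 'I_T -> 'I_n) (S : config n m) v w :
  w \notin S v -> kernel_load c S v w = 0.
Proof.
move=> wS; apply: big1 => f _; case: (Req_dec (kernel c f S) 0) => [->|/kernel_neq0].
  by rewrite Rmult_0_l.
rewrite inE => /andP[_ /forallP fS]; rewrite (_ : [set _ | _] = set0) ?cards0 /=; first lra.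
apply/setP => j; rewrite !inE; apply/negP => /andP[/eqP cj /eqP fj].
by move: (fS j); rewrite cj fj (negbTE wS).
Qed.

(** Transposing [w] and [w'] for the owner [v] alone fixes [S] and exchanges the balls of [v] in the
    two bins. *)
Lemma kernel_load_swap (T n m : nat) (c : 'I_T -> 'I_n) (S : config n m) v w w' :
  w \in S v -> w' \in S v -> kernel_load c S v w = kernel_load c S v w'.
Proof.
move=> wS wS'; pose s := [ffun u : 'I_n => if u == v then tperm w w' else 1%g].
have sS : relabel_sets s S = S.
  apply/ffunP => u; rewrite !ffunE; case: eqP => [->|_]; last first.
    by rewrite -[RHS]imset_id; apply: eq_imset => z; rewrite perm1.
  apply/eqP; rewrite eqEcard card_imset ?leqnn ?andbT; last exact: perm_inj.
  by apply/subsetP => _ /imsetP[z zS ->]; case: tpermP.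
rewrite /kernel_load [RHS](reindex (relabel_balls c s)); last first.
  exact/onW_bij/relabel_balls_bij.
apply: eq_bigr => f _; rewrite -[in RHS]sS kernel_relabel; congr (_ * INR _).
apply: eq_card => j; rewrite !inE !ffunE; case: eqP => //= _.
by rewrite -(inj_eq (@perm_inj _ (tperm w w'))) tpermL.
Qed.

Lemma sum_kernel_load (T n m : nat) (c : 'I_T -> 'I_n) (S : config n m) v :
  \sum_w kernel_load c S v w = INR (fiber_card c v) * kernel_mass c S.
Proof.
rewrite exchange_big /= /kernel_mass big_distrr; apply: eq_bigr => f _ /=.
rewrite -big_distrr /= Rmult_comm -INR_sum; congr (INR _ * _).
under eq_bigr do rewrite card_set_sum.
rewrite exchange_big /fiber_card card_set_sum; apply: eq_bigr => j _ /=.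
rewrite (bigD1 (f j)) //= eqxx andbT big1 ?addn0 // => w /negbTE.
by rewrite eq_sym => ->; rewrite andbF.
Qed.

(** The [#|S v|] balls of [v] all fall in [S v], and by symmetry they are spread evenly in the mean:
    one ball per bin. *)
Lemma kernel_load_in (T n m : nat) (c : 'I_T -> 'I_n) (S : config n m) v w :
  S \in size_class m (fiber_card c) -> w \in S v ->
  kernel_load c S v w = kernel_mass c S.
Proof.
rewrite inE => /forallP /(_ v) /eqP cS wS; have := sum_kernel_load c S v.
rewrite (bigID (mem (S v))) /= [X in _ + X]big1; last by move=> z; apply: kernel_load_notin.
rewrite (eq_bigr (fun=> kernel_load c S v w)); last by move=> z zS; apply: kernel_load_swap.
rewrite Rsum_const cS Rplus_0_r => /Rmult_eq_reg_l; apply.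
by apply/Rgt_not_eq/INR_gt0; rewrite -cS; apply/card_gt0P; exists w.
Qed.

(* The conditional mean of the load vector of [f] given the completed configuration [S] is
   the load vector of [S]. *)
Lemma kernel_load_total (T n m : nat) (c : 'I_T -> 'I_n) (S : config n m) w :
  S \in size_class m (fiber_card c) ->
  \sum_f kernel c f S * INR (load f w) = kernel_mass c S * INR #|[set v | w \in S v]|.
Proof.
move=> SC; transitivity (\sum_v kernel_load c S v w).
  rewrite exchange_big; apply: eq_bigr => f _ /=; rewrite -big_distrr -INR_sum /=.
  congr (_ * INR _); rewrite /load card_set_sum.
  under [in RHS]eq_bigr do rewrite card_set_sum.
  rewrite exchange_big; apply: eq_bigr => j _ /=.
  rewrite (bigD1 (c j)) //= eqxx big1 ?addn0 // => v /negbTE.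
  by rewrite eq_sym => ->.
rewrite card_set_sum INR_sum big_distrr; apply: eq_bigr => v _ /=.
case wS: (w \in S v); first by rewrite kernel_load_in //= Rmult_1_r.
by rewrite kernel_load_notin ?wS //= Rmult_0_r.
Qed.

(** Jensen's inequality for the maximum: a bin [w] attaining [omega' S] is held fixed, and
    [load f w <= max_load f] is applied inside the mean. *)
Lemma kernel_omega'_le (T n m : nat) (c : 'I_T -> 'I_n) (S : config n m) :
  (0 < m)%N -> S \in size_class m (fiber_card c) ->
  kernel_mass c S * INR (omega' S) <= \sum_f kernel c f S * INR (max_load f).
Proof.
move=> m0 SC.
have [|w ew] := @eq_bigmax _ (fun w => #|[set v | w \in S v]|); first by rewrite card_ord.
rewrite /omega' ew -kernel_load_total //; apply: Rsum_le => f _.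
apply: Rmult_le_compat_l; first exact: kernel_ge0.
exact/INR_leq/load_le_max.
Qed.

Lemma label_load_le_omega' (T n m : nat) (c : 'I_T -> 'I_n) (f : {ffun 'I_T -> 'I_m}) S :
  S \in completions c f -> (label_load c f <= omega' S)%N.
Proof.
rewrite inE => /andP[_ /forallP fS]; apply/bigmax_leqP => b _.
apply: leq_trans (leq_bigmax (F := fun w => #|[set v | w \in S v]|) b).
apply/subset_leq_card/subsetP => _ /imsetP[j + ->]; rewrite !inE => /eqP <-.
exact: fS.
Qed.

(** * Comparison of means *)

(** Twice the truncated total variation distance [dTV_upto]. *)
Definition l1_dist (K : nat) (p q : nat -> R) : R := \sum_(0 <= i < K) Rabs (p i - q i).

Lemma l1_dist_triangle K p q r : l1_dist K p r <= l1_dist K p q + l1_dist K q r.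
Proof.
rewrite /l1_dist -big_split; apply: Rsum_le => i _ /=.
by apply: Rle_trans (Rabs_triang _ _); right; congr Rabs; ring.
Qed.

Lemma l1_dist_sym K p q : l1_dist K p q = l1_dist K q p.
Proof. by apply: eq_bigr => i _; apply: Rabs_minus_sym. Qed.

Definition ball_mean (N m : nat) (F : {ffun 'I_N -> 'I_m} -> nat) : R :=
  (\sum_f INR (F f)) / INR m ^ N.

Definition mean_load (N m : nat) : R := ball_mean (@max_load N m).

Definition mean_load_pairs (N m : nat) : R :=
  ball_mean (fun f : {ffun 'I_N -> 'I_m} => (max_load f * (max_load f).-1)%N).

Lemma INR_pow_gt0 m N : (0 < m)%N -> 0 < INR m ^ N.
Proof. by move=> m0; apply/pow_lt/INR_gt0. Qed.

Lemma INR_card_balls (N m : nat) : INR #|{: {ffun 'I_N -> 'I_m}}| = INR m ^ N.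
Proof. by rewrite card_ffun !card_ord INR_expn. Qed.

Lemma ball_mean_ge0 (N m : nat) (F : {ffun 'I_N -> 'I_m} -> nat) :
  (0 < m)%N -> 0 <= ball_mean F.
Proof.
move=> m0; apply: Rmult_le_pos; first by apply: Rsum_ge0 => f _; apply: pos_INR.
exact/Rlt_le/Rinv_0_lt_compat/INR_pow_gt0.
Qed.

Lemma M_pmfE (N m i : nat) :
  M_pmf N m i = \sum_(f : {ffun 'I_N -> 'I_m}) / INR m ^ N * indic (max_load f == i).
Proof. by apply: eq_bigr => f _; case: (_ == _); rewrite /indic; ring. Qed.

Lemma M_pmf_ge0 (N m i : nat) : (0 < m)%N -> 0 <= M_pmf N m i.
Proof.
move=> m0; rewrite M_pmfE; apply: Rsum_ge0 => f _; apply: Rmult_le_pos (indic_ge0 _).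
exact/Rlt_le/Rinv_0_lt_compat/INR_pow_gt0.
Qed.

Lemma sum_M_pmf_le1 (N m K : nat) : (0 < m)%N -> \sum_(0 <= i < K) M_pmf N m i <= 1.
Proof.
move=> m0; have mN := INR_pow_gt0 N m0.
under eq_bigr do rewrite M_pmfE; rewrite exchange_big /=.
apply: (Rle_trans _ (\sum_(f : {ffun 'I_N -> 'I_m}) / INR m ^ N)).
  apply: Rsum_le => f _; rewrite -big_distrr /=; have := sum_indic_eq_le1 K (max_load f).
  by have := Rinv_0_lt_compat _ mN; nra.
by rewrite Rsum_constT INR_card_balls Rinv_r; [apply: Rle_refl|apply: Rgt_not_eq].
Qed.

(** Deleting a ball from a uniform throw of [N.+1] balls gives a uniform throw of [N] balls (the
    identity [avg]) and cannot raise the maximal load. *)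
Lemma l1_M_pmf_succ (K N m : nat) : (0 < m)%N ->
  l1_dist K (M_pmf N m) (M_pmf N.+1 m) <= 2 * (mean_load N.+1 m - mean_load N m).
Proof.
move=> m0; have mN := INR_pow_gt0 N m0; have mp := INR_gt0 m0.
have avg (F : {ffun 'I_N -> 'I_m} -> R) :
    \sum_(g : {ffun 'I_N -> 'I_m}) / INR m ^ N * F g
    = \sum_(f : {ffun 'I_N.+1 -> 'I_m}) / INR m ^ N.+1 * F (delete_ball ord0 f).
  rewrite (big_insert_ball _ ord0) /=.
  under [in RHS]eq_bigr do under eq_bigr do rewrite insert_ballK.
  rewrite Rsum_constT card_ord -!big_distrr /= Rinv_mult -!Rmult_assoc.
  by rewrite Rinv_r ?Rmult_1_l //; apply: Rgt_not_eq.
have := @coupling_bound {ffun 'I_N.+1 -> 'I_m} (fun=> / INR m ^ N.+1)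
  (fun f => max_load (delete_ball ord0 f)) (@max_load N.+1 m) K.
move=> /(_ (fun=> Rlt_le _ _ (Rinv_0_lt_compat _ (INR_pow_gt0 N.+1 m0))))
  /(_ (fun f _ => max_load_delete_ball ord0 f)) bd.
apply: Rle_trans (Rle_trans _ _ _ _ bd) _.
  by apply: Rsum_le => i _; rewrite !M_pmfE avg; apply: Rle_refl.
under eq_bigr do rewrite Rmult_minus_distr_l.
rewrite Rsum_sub -(avg (fun g => INR (max_load g))) -!big_distrr /=.
by right; rewrite /mean_load /ball_mean /Rdiv ![in RHS](Rmult_comm _ (/ _)).
Qed.

Lemma l1_M_pmf_mono (K a b m : nat) : (0 < m)%N -> (a <= b)%N ->
  l1_dist K (M_pmf a m) (M_pmf b m) <= 2 * (mean_load b m - mean_load a m).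
Proof.
move=> m0 /subnKC <-; elim: (b - a)%N => [|k IH].
  rewrite addn0 /l1_dist big1 ?Rminus_diag; first lra.
  by move=> i _; rewrite Rminus_diag Rabs_R0.
have := l1_dist_triangle K (M_pmf a m) (M_pmf (a + k) m) (M_pmf (a + k.+1) m).
by rewrite addnS; have := l1_M_pmf_succ K (a + k) m0; lra.
Qed.

(** Iterates [sum_max_load_succ]; the cross-multiplied form includes [a = 0]. *)
Lemma mean_load_scaling (a b m : nat) : (0 < m)%N -> (a <= b)%N ->
  INR a * mean_load b m <= INR b * mean_load a m.
Proof.
move=> m0; have mp := INR_gt0 m0.
have step N : INR N * mean_load N.+1 m <= INR N.+1 * mean_load N m.
  have := INR_leq (sum_max_load_succ N m); rewrite !INR_muln !INR_sum => le.
  have mN := INR_pow_gt0 N m0; rewrite /mean_load /ball_mean [INR m ^ N.+1]/=.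
  set A := \big[_/_]_f _ in le *; set B := \big[_/_]_f _ in le *.
  apply: (Rmult_le_reg_r (INR m * INR m ^ N)); first exact: Rmult_lt_0_compat.
  rewrite [X in X <= _](_ : _ = INR N * A); last by field; lra.
  by rewrite [X in _ <= X](_ : _ = INR N.+1 * INR m * B) //; field; lra.
case: a => [|a] ab.
  by rewrite Rmult_0_l; apply: Rmult_le_pos (pos_INR _) (ball_mean_ge0 _ m0).
rewrite -(subnKC ab); elim: (b - _)%N => [|k IH]; first by rewrite addn0; apply: Rle_refl.
have kp : 0 < INR (a.+1 + k) by apply: INR_gt0; rewrite addSn.
have ap := pos_INR a.+1; have := step (a.+1 + k)%N; rewrite -addnS.
have := pos_INR (a.+1 + k.+1) => kp1 st.
apply: (Rmult_le_reg_l _ _ _ kp); nra.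
Qed.

(* [L(L-1) <= (a+2)^2 + L(L-1)(L-2)/a], whose last term has mean at most [N^3/m^2]. *)
Lemma mean_load_pairs_le (N m : nat) (a : R) : (0 < m)%N -> 0 < a ->
  a * mean_load_pairs N m <= a * (a + 2) ^ 2 + INR N ^ 3 / INR m ^ 2.
Proof.
move=> m0 a0; have mp := INR_gt0 m0; have mN := INR_pow_gt0 N m0.
pose cube (f : {ffun 'I_N -> 'I_m}) := (max_load f ^_ 3)%N.
have mean_cube : ball_mean cube <= INR N ^ 3 / INR m ^ 2.
  have := INR_leq (sum_binom_max_load 3 N m0).
  rewrite INR_muln INR_expn INR_muln INR_expn INR_sum => le.
  have f3 : INR 3`! = 6 by rewrite !factS fact0 !INR_muln !S_INR /=; ring.
  have e : \sum_f INR (cube f) = 6 * \sum_(f : {ffun 'I_N -> 'I_m}) INR 'C(max_load f, 3).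
    rewrite big_distrr; apply: eq_bigr => f _ /=; rewrite /cube -bin_ffact INR_muln.
    by rewrite f3 Rmult_comm.
  have b3 : 6 * INR 'C(N, 3) <= INR N ^ 3.
    rewrite -INR_expn -f3 -INR_muln.
    apply: INR_leq; rewrite mulnC bin_ffact !ffactnS ffactn0 muln1 !expnS expn0 muln1.
    by rewrite !leq_mul // ?leq_pred // (leq_trans (leq_pred _)) ?leq_pred.
  rewrite /ball_mean e; apply: (Rmult_le_reg_r (INR m ^ 3 * INR m ^ N)).
    by apply: Rmult_lt_0_compat; [apply: INR_pow_gt0|].
  rewrite [X in _ <= X](_ : _ = INR N ^ 3 * INR m ^ N.+1); last by rewrite /=; field; lra.
  rewrite [X in X <= _](_ : _
    = 6 * (INR m ^ 3 * \sum_(f : {ffun 'I_N -> 'I_m}) INR 'C(max_load f, 3)));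
    last by field; lra.
  apply: Rle_trans (Rmult_le_compat_l 6 _ _ _ le) _; first lra.
  rewrite -Rmult_assoc; apply: Rmult_le_compat_r b3.
  exact/Rlt_le/INR_pow_gt0.
apply: Rle_trans (Rplus_le_compat_l _ _ _ mean_cube).
have -> : a * (a + 2) ^ 2 =
    (\sum_(f : {ffun 'I_N -> 'I_m}) a * (a + 2) ^ 2) / INR m ^ N.
  by rewrite Rsum_constT INR_card_balls; field; lra.
rewrite /mean_load_pairs /ball_mean /Rdiv -Rmult_plus_distr_r -Rmult_assoc.
apply: Rmult_le_compat_r; first exact/Rlt_le/Rinv_0_lt_compat.
rewrite big_distrr -big_split; apply: Rsum_le => f _ /=; rewrite /cube.
rewrite !ffactnS ffactn0 muln1 !INR_muln.
(* Loads 0 and 1 are treated apart, so that the truncated predecessors become real subtractions. *)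
case: (max_load f) => [|[|l]]; try by rewrite /=; nra.
rewrite !succnK; set x := INR l.+2.
have x2 : 2 <= x by rewrite /x !S_INR; have := pos_INR l; lra.
have -> : INR l.+1 = x - 1 by rewrite /x (S_INR l.+1); ring.
have -> : INR l = x - 2 by rewrite /x !S_INR; ring.
have y0 : 0 <= x * (x - 1) by nra.
case: (Rle_dec x (a + 2)) => xa.
  have le : x * (x - 1) <= (a + 2) ^ 2 by nra.
  have := Rmult_le_compat_l a _ _ (Rlt_le _ _ a0) le.
  have := Rmult_le_pos _ (x - 2) y0; lra.
have le : a <= x - 2 by lra.
have := Rmult_le_compat_r _ _ _ y0 le; have := pow2_ge_0 (a + 2); nra.
Qed.

(** Pointwise [L <= a + 1 + L (L - 1) / a], by cases on [L - 1 <= a]. *)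
Lemma mean_load_le (N m : nat) (a : R) : (0 < m)%N -> 0 < a ->
  a * mean_load N m <= a * (a + 1) + mean_load_pairs N m.
Proof.
move=> m0 a0; have mp := INR_gt0 m0; have mN := INR_pow_gt0 N m0.
have -> : a * (a + 1) = (\sum_(f : {ffun 'I_N -> 'I_m}) a * (a + 1)) / INR m ^ N.
  by rewrite Rsum_constT INR_card_balls; field; lra.
rewrite /mean_load /mean_load_pairs /ball_mean /Rdiv -Rmult_plus_distr_r -Rmult_assoc.
apply: Rmult_le_compat_r; first exact/Rlt_le/Rinv_0_lt_compat.
rewrite big_distrr -big_split; apply: Rsum_le => f _ /=.
case: (max_load f) => [|l]; first by rewrite /=; nra.
rewrite INR_muln /= -/(INR l.+1) S_INR; have := pos_INR l => l0.
by case: (Rle_dec (INR l) a) => la; nra.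
Qed.

Definition mean_label_load (T n m : nat) (c : 'I_T -> 'I_n) : R :=
  ball_mean (fun f : {ffun 'I_T -> 'I_m} => label_load c f).

Definition label_pmf (T n m : nat) (c : 'I_T -> 'I_n) (i : nat) : R :=
  \sum_(f : {ffun 'I_T -> 'I_m}) / INR m ^ T * indic (label_load c f == i).

Lemma l1_label_pmf (T n m K : nat) (c : 'I_T -> 'I_n) : (0 < m)%N ->
  l1_dist K (label_pmf m c) (M_pmf T m) <= 2 * (mean_load T m - mean_label_load m c).
Proof.
move=> m0; have mT := INR_pow_gt0 T m0.
have := @coupling_bound {ffun 'I_T -> 'I_m} (fun=> / INR m ^ T)
  (fun f => label_load c f) (@max_load T m) K.
move=> /(_ (fun=> Rlt_le _ _ (Rinv_0_lt_compat _ mT))) /(_ (fun f _ => label_load_le c f)) bd.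
apply: Rle_trans (Rle_trans _ _ _ _ bd) _.
  by apply: Rsum_le => i _; rewrite M_pmfE; apply: Rle_refl.
rewrite -big_distrr Rsum_sub /mean_load /mean_label_load /ball_mean /Rdiv /=.
by right; rewrite (Rmult_comm (/ _)) Rmult_minus_distr_r.
Qed.

Lemma mean_label_load_ge (T n m : nat) (c : 'I_T -> 'I_n) : (0 < m)%N ->
  INR T * INR T.-1 * (mean_load T m - mean_label_load m c)
    <= INR (collisions c) * mean_load_pairs T m.
Proof.
move=> m0; have mT := INR_pow_gt0 T m0.
have := INR_leq (sum_label_load c m0).
rewrite !(INR_addn, INR_muln) !INR_sum => le.
apply: (Rmult_le_reg_r (INR m ^ T)) => //.
rewrite /mean_load /mean_label_load /mean_load_pairs /ball_mean.
rewrite Rmult_minus_distr_l Rmult_minus_distr_r /Rdiv.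
rewrite !Rmult_assoc Rinv_l ?Rmult_1_r -?Rmult_assoc; last exact: Rgt_not_eq.
lra.
Qed.

(** The conditional law of [omega'] given the set sizes [x], under which the configuration is
    uniform on its class. *)
Definition class_pmf (n m : nat) (x : 'I_n -> nat) (i : nat) : R :=
  (\sum_(S in size_class m x) indic (omega' S == i)) / INR #|size_class m x|.

(** The masses over the class are equal and add up to the number [m ^ T] of throws. *)
Lemma kernel_massE (T n m : nat) (c : 'I_T -> 'I_n) S :
  (forall v, fiber_card c v <= m)%N -> S \in size_class m (fiber_card c) ->
  kernel_mass c S * INR #|size_class m (fiber_card c)| = INR m ^ T.
Proof.
move=> xm SC; rewrite -INR_card_balls Rmult_comm -Rsum_const.
rewrite (eq_bigr (kernel_mass c)); last by move=> S' SC'; apply: kernel_mass_const.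
rewrite /kernel_mass -[RHS]Rmult_1_r -Rsum_constT.
rewrite [RHS](eq_bigr (fun f => \sum_S kernel c f S)); last first.
  by move=> f _; rewrite sum_kernel.
rewrite exchange_big /=; apply: eq_bigr => f _.
rewrite [RHS](bigID (mem (size_class m (fiber_card c)))) /= [X in _ + X]big1 ?Rplus_0_r //.
move=> S' SC'; case: (Req_dec (kernel c f S') 0) => // /kernel_neq0.
by rewrite inE (negbTE SC').
Qed.

Lemma class_sumE (T n m : nat) (c : 'I_T -> 'I_n) (F : config n m -> R) :
  (0 < m)%N -> (forall v, fiber_card c v <= m)%N ->
  (\sum_(S in size_class m (fiber_card c)) F S) / INR #|size_class m (fiber_card c)|
  = \sum_(S : config n m) kernel_mass c S / INR m ^ T * F S.
Proof.
move=> m0 xm; have mT := INR_pow_gt0 T m0.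
rewrite [RHS](bigID (mem (size_class m (fiber_card c)))) /= [X in _ + X]big1 ?Rplus_0_r.
  rewrite /Rdiv big_distrl; apply: eq_bigr => S SC /=.
  have C0 : 0 < INR #|size_class m (fiber_card c)|.
    by apply: INR_gt0; apply/card_gt0P; exists S.
  have k0 : kernel_mass c S <> 0 by move=> k0; have := kernel_massE xm SC; rewrite k0; lra.
  rewrite Rmult_comm; congr Rmult; rewrite -(kernel_massE xm SC).
  by rewrite Rinv_mult -Rmult_assoc Rinv_r ?Rmult_1_l.
move=> S SC; rewrite /kernel_mass big1 => [|f _]; first by rewrite /Rdiv; ring.
case: (Req_dec (kernel c f S) 0) => // /kernel_neq0.
by rewrite inE (negbTE SC).
Qed.

(** Under the joint law [w] of a throw and its completion the owner count is at most [omega'], so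
    the coupling bound applies; the mean of [omega'] is then bounded by that of [max_load] through
    [kernel_omega'_le]. *)
Lemma l1_class_pmf (T n m K : nat) (c : 'I_T -> 'I_n) :
  (0 < m)%N -> (forall v, fiber_card c v <= m)%N ->
  l1_dist K (label_pmf m c) (class_pmf m (fiber_card c))
    <= 2 * (mean_load T m - mean_label_load m c).
Proof.
move=> m0 xm; have mT := INR_pow_gt0 T m0; have imT := Rinv_0_lt_compat _ mT.
pose w (t : {ffun 'I_T -> 'I_m} * config n m) := / INR m ^ T * kernel c t.1 t.2.
have w0 t : 0 <= w t by apply: Rmult_le_pos; [lra|apply: kernel_ge0].
have wle t : w t <> 0 -> (label_load c t.1 <= omega' t.2)%N.
  move=> wt; apply/label_load_le_omega'/kernel_neq0 => k0; apply: wt.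
  by rewrite /w k0 Rmult_0_r.
have sum_f (F : {ffun 'I_T -> 'I_m} -> R) : \sum_f / INR m ^ T * F f = \sum_t w t * F t.1.
  rewrite -(pair_bigA _ (fun f S => w (f, S) * F f)) /=; apply: eq_bigr => f _.
  by rewrite -big_distrl /w -big_distrr /= sum_kernel // Rmult_1_r.
have sum_S (F : config n m -> R) :
    \sum_(S : config n m) kernel_mass c S / INR m ^ T * F S = \sum_t w t * F t.2.
  rewrite -(pair_bigA _ (fun f S => w (f, S) * F S)) /= exchange_big /=.
  apply: eq_bigr => S _; rewrite -big_distrl /w -big_distrr /= -/(kernel_mass c S).
  by rewrite /Rdiv; ring.
apply: Rle_trans (Rle_trans _ _ _ _ (coupling_bound K w0 wle)) _.
  right; apply: eq_bigr => i _; congr (Rabs (_ - _)); first by rewrite /label_pmf sum_f.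
  by rewrite /class_pmf class_sumE // sum_S.
apply: Rmult_le_compat_l; first lra.
under eq_bigr do rewrite Rmult_minus_distr_l.
rewrite Rsum_sub -(sum_f (fun f => INR (label_load c f))) -(sum_S (fun S => INR (omega' S))).
apply: Rplus_le_compat; last first.
  by right; rewrite /mean_label_load /ball_mean -big_distrr /Rdiv /= Rmult_comm.
apply: (Rle_trans _ (\sum_(S : config n m) \sum_f w (f, S) * INR (max_load f))).
  apply: Rsum_le => S _; case: (boolP (S \in size_class m (fiber_card c))) => SC.
    rewrite (eq_bigr (fun f => / INR m ^ T * (kernel c f S * INR (max_load f)))); last first.
      by move=> f _; rewrite /w Rmult_assoc.
    rewrite -big_distrr /= /Rdiv (Rmult_comm (kernel_mass _ _)) Rmult_assoc.
    exact: Rmult_le_compat_l (Rlt_le _ _ imT) (kernel_omega'_le m0 SC).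
  rewrite /kernel_mass big1 => [|f _].
    rewrite /Rdiv !Rmult_0_l; apply: Rsum_ge0 => f _; exact: Rmult_le_pos (w0 _) (pos_INR _).
  case: (Req_dec (kernel c f S) 0) => // /kernel_neq0.
  by rewrite inE (negbTE SC).
rewrite exchange_big (pair_bigA _ (fun f S => w (f, S) * INR (max_load f))) /=.
right; rewrite /mean_load /ball_mean /Rdiv Rmult_comm big_distrr /= sum_f.
by apply: eq_bigr => -[].
Qed.

(** * Moments of the set sizes and conditioning on them *)

Lemma sum_subset_prob (m : nat) (P : nat -> R) (g : nat -> R) :
  \sum_(A : {set 'I_m}) subset_prob P A * g #|A| = \sum_(0 <= k < m.+1) g k * P k.
Proof.
have cm (A : {set 'I_m}) : (#|A| < m.+1)%N.
  by rewrite ltnS (leq_trans (max_card _)) ?card_ord.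
rewrite big_mkord (partition_big (fun A : {set 'I_m} => Ordinal (cm A)) predT) //=.
apply: eq_bigr => k _.
rewrite (eq_bigr (fun=> P k / INR 'C(m, k) * g k)) => [|A /eqP e]; last first.
  by rewrite /subset_prob -e.
rewrite (eq_bigl (fun A => A \in [set A : {set 'I_m} | #|A| == k])); last first.
  by move=> A; rewrite inE -val_eqE.
rewrite Rsum_const card_draws card_ord /Rdiv.
have C0 : INR 'C(m, k) <> 0 by apply/Rgt_not_eq/INR_gt0; rewrite bin_gt0 -ltnS.
by field.
Qed.

Lemma sum_config_prod (n m : nat) (P : nat -> R) (G : 'I_n -> {set 'I_m} -> R) :
  \sum_(S : config n m) config_prob P S * \big[Rmult/R1]_v G v (S v)
  = \big[Rmult/R1]_v \sum_(A : {set 'I_m}) subset_prob P A * G v A.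
Proof.
rewrite bigA_distr_bigA; apply: eq_bigr => S _.
by rewrite /config_prob /rprod -big_split.
Qed.

(** Writes a function of one coordinate as a product over all of them, the shape that
    [sum_config_prod] asks for. *)
Lemma prod_at (n : nat) (u : 'I_n) (a : 'I_n -> R) :
  \big[Rmult/R1]_v (if v == u then a v else 1) = a u.
Proof. by rewrite -big_mkcond big_pred1_eq. Qed.

Lemma prob_on_total (m : nat) (P : nat -> R) :
  is_prob_on m P -> \sum_(A : {set 'I_m}) subset_prob P A = 1.
Proof.
case=> _ <-; rewrite /rsumn.
rewrite (eq_bigr (fun A : {set 'I_m} => subset_prob P A * 1)) => [|A _]; last by ring.
by rewrite (sum_subset_prob m P (fun=> 1)); apply: eq_bigr => k _; ring.
Qed.

Lemma config_prob_ge0 (n m : nat) (P : nat -> R) (S : config n m) :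
  is_prob_on m P -> 0 <= config_prob P S.
Proof.
case=> P0 _; rewrite /config_prob /rprod; elim/big_ind: _ => [|x y|v _]; first lra.
  exact: Rmult_le_pos.
have cm : (#|S v| <= m)%N by rewrite (leq_trans (max_card _)) ?card_ord.
apply: Rmult_le_pos; first exact: P0.
by apply/Rlt_le/Rinv_0_lt_compat/INR_gt0; rewrite bin_gt0.
Qed.

Lemma sum_config_at (n m : nat) (P : nat -> R) (u : 'I_n) (F : {set 'I_m} -> R) :
  is_prob_on m P ->
  \sum_(S : config n m) config_prob P S * F (S u) = \sum_(A : {set 'I_m}) subset_prob P A * F A.
Proof.
move=> hP; rewrite (eq_bigr (fun S => config_prob P S *
    \big[Rmult/R1]_v (if v == u then F (S v) else 1))); last first.
  by move=> S _; rewrite (prod_at u (fun v => F (S v))).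
rewrite (sum_config_prod P (fun v A => if v == u then F A else 1)) (bigD1 u) //= eqxx.
rewrite [X in _ * X]big1 ?Rmult_1_r // => v /negbTE ->.
by rewrite -[RHS](prob_on_total hP); apply: eq_bigr => A _; rewrite Rmult_1_r.
Qed.

Lemma sum_config_uncorrelated (n m : nat) (P : nat -> R) (u v : 'I_n) (F : {set 'I_m} -> R) :
  u != v -> \sum_(A : {set 'I_m}) subset_prob P A * F A = 0 ->
  \sum_(S : config n m) config_prob P S * (F (S u) * F (S v)) = 0.
Proof.
move=> uv F0; rewrite (eq_bigr (fun S => config_prob P S * \big[Rmult/R1]_i
    ((if i == u then F (S i) else 1) * (if i == v then F (S i) else 1)))); last first.
  by move=> S _; rewrite big_split /= !(prod_at _ (fun i => F (S i))).
rewrite (sum_config_prod P (fun i A => (if i == u then F A else 1) * (if i == v then F A else 1))).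
rewrite (bigD1 u) //= eqxx (negbTE uv); under eq_bigr do rewrite Rmult_1_r.
by rewrite F0 Rmult_0_l.
Qed.

Lemma sum_config_prob (n m : nat) (P : nat -> R) :
  is_prob_on m P -> \sum_(S : config n m) config_prob P S = 1.
Proof.
move=> hP; have := sum_config_prod P (fun (v : 'I_n) (A : {set 'I_m}) => 1).
rewrite [X in _ = X]big1 => [e|v _].
  by rewrite -[RHS]e; apply: eq_bigr => S _; rewrite big1 // Rmult_1_r.
by rewrite -[RHS](prob_on_total hP); apply: eq_bigr => A _; rewrite Rmult_1_r.
Qed.

Lemma sum_config_sqr (n m : nat) (P : nat -> R) : is_prob_on m P ->
  \sum_(S : config n m) config_prob P S * (\sum_v INR #|S v| ^ 2) = INR n * EX2 m P.
Proof.
move=> hP; under eq_bigr do rewrite big_distrr /=.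
rewrite exchange_big /= (eq_bigr (fun=> EX2 m P)) => [|v _].
  by rewrite Rsum_constT card_ord.
rewrite (sum_config_at v (fun A => INR #|A| ^ 2) hP).
exact: (sum_subset_prob m P (fun k => INR k ^ 2)).
Qed.

Lemma sum_config_var (n m : nat) (P : nat -> R) : is_prob_on m P ->
  \sum_(S : config n m) config_prob P S * (\sum_v INR #|S v| - INR n * EX m P) ^ 2
  = INR n * (EX2 m P - EX m P ^ 2).
Proof.
move=> hP; pose F (A : {set 'I_m}) := INR #|A| - EX m P.
have EF : \sum_(A : {set 'I_m}) subset_prob P A * INR #|A| = EX m P.
  exact: (sum_subset_prob m P INR).
have F0 : \sum_(A : {set 'I_m}) subset_prob P A * F A = 0.
  under eq_bigr do rewrite Rmult_minus_distr_l.
  by rewrite Rsum_sub EF -big_distrl /= (prob_on_total hP) Rmult_1_l Rminus_diag.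
have F2 : \sum_(A : {set 'I_m}) subset_prob P A * (F A * F A) = EX2 m P - EX m P ^ 2.
  (* With [x = #|A|] and [e = EX m P], [(x - e)^2 = x^2 - e x - e (x - e)], whose last term has mean
     zero. *)
  rewrite (eq_bigr (fun A : {set 'I_m} => subset_prob P A * INR #|A| ^ 2
      - EX m P * (subset_prob P A * INR #|A|) - EX m P * (subset_prob P A * F A))); last first.
    by move=> A _; rewrite /F; ring.
  rewrite !Rsum_sub -!big_distrr /= F0 EF (sum_subset_prob m P (fun k => INR k ^ 2)).
  by rewrite /EX2 /rsumn Rmult_0_r Rminus_0_r Rmult_1_r.
(* The square is expanded over ordered pairs of vertices; off-diagonal pairs have mean zero because
   [F] is centred. *)
rewrite (eq_bigr (fun S => \sum_u \sum_v config_prob P S * (F (S u) * F (S v)))); last first.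
  move=> S _; rewrite (_ : _ - _ = \sum_v F (S v)); last first.
    by rewrite /F Rsum_sub Rsum_constT card_ord.
  rewrite /= Rmult_1_r big_distrl big_distrr; apply: eq_bigr => u _ /=.
  by rewrite big_distrr big_distrr.
rewrite exchange_big (eq_bigr (fun=> EX2 m P - EX m P ^ 2)) => [|u _].
  by rewrite Rsum_constT card_ord.
rewrite exchange_big (bigD1 u) //= [X in _ + X]big1 => [|v vu].
  by rewrite (sum_config_at u (fun A => F A * F A) hP) F2 Rplus_0_r.
by apply: sum_config_uncorrelated; rewrite // eq_sym.
Qed.

Lemma config_prob_class (n m : nat) (P : nat -> R) (S S' : config n m) :
  S \in size_class m (fun v => #|S' v|) -> config_prob P S = config_prob P S'.
Proof.
rewrite inE => /forallP e; apply: eq_bigr => v _.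
by rewrite /subset_prob (eqP (e v)).
Qed.

(** [config_prob] depends only on the set sizes, so it is constant on each class. After exchanging
    the sums, [S'] is counted once for each of the [#|cls S'|] members of its class, which cancels
    the normalisation. *)
Lemma omega'_pmf_mixture (n m : nat) (P : nat -> R) (i : nat) :
  omega'_pmf n m P i
  = \sum_(S : config n m) config_prob P S * class_pmf m (fun v => #|S v|) i.
Proof.
pose cls (S : config n m) := size_class m (fun v => #|S v|).
have clsC S S' : (S' \in cls S) = (S \in cls S').
  by rewrite !inE; apply: eq_forallb => v; rewrite eq_sym.
have cls_eq S S' : S' \in cls S -> cls S = cls S'.
  rewrite inE => /forallP e; apply/setP => U; rewrite !inE.
  by apply: eq_forallb => v; rewrite (eqP (e v)).
rewrite (eq_bigr (fun S => \sum_(S' : config n m) indic (S' \in cls S) *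
    (config_prob P S' * indic (omega' S' == i) / INR #|cls S'|))); last first.
  move=> S _; rewrite /class_pmf -/(cls S) -sum_indic_in /Rdiv big_distrl big_distrr /=.
  apply: eq_bigr => S' _; case S'S: (S' \in cls S); rewrite /indic ?Rmult_0_l ?Rmult_0_r //.
  by rewrite (config_prob_class P S'S) -(cls_eq _ _ S'S) !Rmult_1_l Rmult_assoc.
rewrite exchange_big; apply: eq_bigr => S' _ /=.
rewrite -big_distrl /=; under eq_bigr do rewrite clsC -[indic _]Rmult_1_r.
rewrite (sum_indic_in (cls S') (fun=> 1)) Rsum_const Rmult_1_r.
have c0 : INR #|cls S'| <> 0.
  apply/Rgt_not_eq/INR_gt0/card_gt0P; exists S'.
  by rewrite inE; apply/forallP => v.
rewrite /Rdiv Rmult_comm Rmult_assoc Rinv_l // Rmult_1_r.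
by case: (_ == _); rewrite /indic ?Rmult_1_r ?Rmult_0_r.
Qed.

Lemma eq_class_pmf (n m : nat) (x y : 'I_n -> nat) i :
  x =1 y -> class_pmf m x i = class_pmf m y i.
Proof.
move=> xy; rewrite /class_pmf (_ : size_class m x = size_class m y) //.
by apply/setP => S; rewrite !inE; apply: eq_forallb => v; rewrite xy.
Qed.

Lemma class_pmf_ge0 (n m : nat) (x : 'I_n -> nat) i : 0 <= class_pmf m x i.
Proof.
rewrite /class_pmf; case: (posnP #|size_class m x|) => [/eqP|c0].
  by rewrite cards_eq0 => /eqP ->; rewrite big_set0 /Rdiv Rmult_0_l; apply: Rle_refl.
apply: Rmult_le_pos; first by apply: Rsum_ge0 => S _; apply: indic_ge0.
exact/Rlt_le/Rinv_0_lt_compat/INR_gt0.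
Qed.

Lemma sum_class_pmf_le1 (n m : nat) (x : 'I_n -> nat) K :
  \sum_(0 <= i < K) class_pmf m x i <= 1.
Proof.
rewrite /class_pmf /Rdiv -big_distrl exchange_big /=.
case: (posnP #|size_class m x|) => [/eqP|c0].
  by rewrite cards_eq0 => /eqP ->; rewrite big_set0 Rmult_0_l; lra.
have := INR_gt0 c0 => c0'; apply: (Rmult_le_reg_r _ _ _ c0').
rewrite Rmult_assoc Rinv_l ?Rmult_1_r ?Rmult_1_l; last exact: Rgt_not_eq.
rewrite -[X in _ <= X]Rmult_1_r -Rsum_const; apply: Rsum_le => S _.
exact: sum_indic_eq_le1.
Qed.

Lemma l1_dist_le2 K p q : (forall i, 0 <= p i) -> (forall i, 0 <= q i) ->
  \sum_(0 <= i < K) p i <= 1 -> \sum_(0 <= i < K) q i <= 1 -> l1_dist K p q <= 2.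
Proof.
move=> p0 q0 p1 q1; apply: (Rle_trans _ (\sum_(0 <= i < K) (p i + q i))).
  apply: Rsum_le => i _; apply: Rle_trans (Rabs_triang _ _) _.
  by rewrite Rabs_Ropp !Rabs_pos_eq //; apply: Rle_refl.
by rewrite big_split /=; lra.
Qed.

(** The path runs from [omega'] to the owner count, to [M(T)], to [M(N)]. The first two legs cost
    [2 * D] each, where [D] is the mean of [M(T)] minus that of the owner count. *)
Lemma l1_class_M_pmf (n m K N : nat) (x : 'I_n -> nat) (T := (\big[addn/0%N]_v x v)%N) :
  (0 < m)%N -> (forall v, x v <= m)%N ->
  exists D : R, l1_dist K (class_pmf m x) (M_pmf N m)
      <= 4 * D + 2 * Rabs (mean_load T m - mean_load N m)
    /\ INR T * INR T.-1 * D <= (\sum_v INR (x v) ^ 2) * mean_load_pairs T m.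
Proof.
move=> m0 xm; have [c cx] := labelling_exists x; rewrite -/T in c cx.
have cm v : (fiber_card c v <= m)%N by rewrite /fiber_card cx.
exists (mean_load T m - mean_label_load m c); split; last first.
  apply: Rle_trans (mean_label_load_ge c m0) _.
  apply: Rmult_le_compat_r; first exact: ball_mean_ge0.
  apply: Rle_trans (INR_leq (collisions_le c)) _; rewrite INR_sum; right.
  by apply: eq_bigr => v _; rewrite cx INR_expn.
have -> : l1_dist K (class_pmf m x) (M_pmf N m)
    = l1_dist K (class_pmf m (fiber_card c)) (M_pmf N m).
  apply: eq_bigr => i _; congr (Rabs (_ - _)); apply: eq_class_pmf => v.
  by rewrite /fiber_card cx.
have d1 := l1_dist_triangle K (class_pmf m (fiber_card c)) (label_pmf m c) (M_pmf N m).
have d2 := l1_dist_triangle K (label_pmf m c) (M_pmf T m) (M_pmf N m).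
have d3 := l1_class_pmf K m0 cm; have d4 := l1_label_pmf K c m0.
rewrite l1_dist_sym in d3.
have d5 : l1_dist K (M_pmf T m) (M_pmf N m) <= 2 * Rabs (mean_load T m - mean_load N m).
  case/orP: (leq_total T N) => TN.
    have := l1_M_pmf_mono K m0 TN; have := Rle_abs (- (mean_load T m - mean_load N m)).
    by rewrite Rabs_Ropp; lra.
  rewrite l1_dist_sym; have := l1_M_pmf_mono K m0 TN.
  by have := Rle_abs (mean_load T m - mean_load N m); lra.
lra.
Qed.

(** For [a <= b], [mean_load_scaling] rearranges to [a (E M(b) - E M(a)) <= (b - a) E M(a)]. *)
Lemma mean_load_diff (a b m : nat) (lo E : R) : (0 < m)%N -> 0 < lo ->
  lo <= INR a -> lo <= INR b -> mean_load a m <= E -> mean_load b m <= E ->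
  lo * Rabs (mean_load a m - mean_load b m) <= Rabs (INR a - INR b) * E.
Proof.
move=> m0 lo0; wlog ab : a b / (a <= b)%N => [H la lb Ea Eb|la lb Ea _].
  case/orP: (leq_total a b) => ab; first exact: H.
  by rewrite Rabs_minus_sym (Rabs_minus_sym (INR a)); apply: H.
have sc := mean_load_scaling m0 ab; have a0 := ball_mean_ge0 (@max_load a m) m0.
rewrite -/(mean_load a m) in a0; have abR := INR_leq ab.
rewrite (Rabs_minus_sym (INR a)) (Rabs_pos_eq (INR b - _)); last lra.
rewrite Rabs_minus_sym; case: (Rle_dec (mean_load a m) (mean_load b m)) => le.
  rewrite Rabs_pos_eq; last lra.
  apply: (Rle_trans _ (INR a * (mean_load b m - mean_load a m))).
    by apply: Rmult_le_compat_r; lra.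
  by apply: (Rle_trans _ ((INR b - INR a) * mean_load a m)); [lra|apply: Rmult_le_compat_l; lra].
have bp : 0 < INR b by lra.
(* With an empty window the distance is zero, so the bound expresses monotonicity of [mean_load] and
   refutes this case. *)
have := l1_M_pmf_mono 0 m0 ab; rewrite /l1_dist big_geq //; lra.
Qed.

(** * Limits *)

(** A configuration violating one of the two bounds is charged the trivial distance 2, which is at
    most twice the ratio of the offending quantity to its bound: Chebyshev's and Markov's
    inequalities, carried out inside the mean. *)
Lemma l1_omega'_le (n m N K : nat) (P : nat -> R) (B Q G : R) :
  (0 < m)%N -> is_prob_on m P -> 0 < B -> 0 < Q -> 0 <= G ->
  (forall S : config n m, (\sum_v INR #|S v| - INR n * EX m P) ^ 2 <= B ->
     \sum_v INR #|S v| ^ 2 <= Q ->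
     l1_dist K (class_pmf m (fun v => #|S v|)) (M_pmf N m) <= G) ->
  l1_dist K (omega'_pmf n m P) (M_pmf N m)
    <= 2 * (INR n * (EX2 m P - EX m P ^ 2)) / B + 2 * (INR n * EX2 m P) / Q + G.
Proof.
move=> m0 hP B0 Q0 G0 close.
have tot := sum_config_prob n hP.
apply: (Rle_trans _ (\sum_(S : config n m) config_prob P S *
    l1_dist K (class_pmf m (fun v => #|S v|)) (M_pmf N m))).
  rewrite /l1_dist; under [X in _ <= X]eq_bigr do rewrite big_distrr /=.
  rewrite exchange_big; apply: Rsum_le => i _ /=.
  have eM : M_pmf N m i = \sum_(S : config n m) config_prob P S * M_pmf N m i.
    by rewrite -big_distrl /= tot Rmult_1_l.
  rewrite omega'_pmf_mixture [in X in X <= _]eM -Rsum_sub.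
  apply: Rle_trans (Rsum_abs _ _ _) _; apply: Rsum_le => S _.
  rewrite -Rmult_minus_distr_l Rabs_mult Rabs_pos_eq; first exact: Rle_refl.
  exact: config_prob_ge0.
rewrite -(sum_config_var n hP) -(sum_config_sqr n hP).
apply: (Rle_trans _ (\sum_(S : config n m)
   (2 / B * (config_prob P S * (\sum_v INR #|S v| - INR n * EX m P) ^ 2)
    + 2 / Q * (config_prob P S * \sum_v INR #|S v| ^ 2) + config_prob P S * G))).
  apply: Rsum_le => S _; set V := (_ - _) ^ 2; set W := \sum_v INR #|S v| ^ 2.
  have V0 : 0 <= V by apply: pow2_ge_0.
  have W0 : 0 <= W by apply: Rsum_ge0 => v _; apply: pow2_ge_0.
  have iB := Rinv_0_lt_compat _ B0; have iQ := Rinv_0_lt_compat _ Q0.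
  rewrite [X in _ <= X](_ : _ = config_prob P S * (2 * (V * / B) + 2 * (W * / Q) + G)); last first.
    by rewrite /Rdiv; ring.
  apply: Rmult_le_compat_l; first exact: config_prob_ge0.
  have VB : 0 <= V * / B by nra.
  have WQ : 0 <= W * / Q by nra.
  have le2 : l1_dist K (class_pmf m (fun v => #|S v|)) (M_pmf N m) <= 2.
    apply: l1_dist_le2 => [i|i||].
    - exact: class_pmf_ge0.
    - exact: M_pmf_ge0.
    - exact: sum_class_pmf_le1.
    - exact: sum_M_pmf_le1.
  case: (Rle_dec V B) => VleB; last first.
    have : 1 <= V * / B by rewrite -(Rinv_r B); [apply: Rmult_le_compat_r|]; lra.
    move=> VW; apply: Rle_trans le2 _; lra.
  case: (Rle_dec W Q) => WleQ; last first.
    have : 1 <= W * / Q by rewrite -(Rinv_r Q); [apply: Rmult_le_compat_r|]; lra.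
    move=> VW; apply: Rle_trans le2 _; lra.
  apply: Rle_trans (close S VleB WleQ) _; lra.
rewrite !big_split -!big_distrr -big_distrl /= tot Rmult_1_l.
right; congr (_ + _ + _); rewrite /Rdiv !Rmult_assoc; congr Rmult; exact: Rmult_comm.
Qed.

(** In the application [q] and [r] are the square roots of [m] and [n], and [M0] is the mean total
    size; [k] is the tolerance for the sizes and [d] the small parameter. The moment bounds are used
    with threshold [a = d * r]. *)
Lemma l1_class_M_pmf_le (n m N K : nat) (x : 'I_n -> nat) (c1 c2 k d q r M0 : R) :
  (0 < m)%N -> (forall v, x v <= m)%N -> INR m = q ^ 2 ->
  0 < c1 -> 2 <= k -> 0 < d <= 1 -> 1 <= q -> 4 * k <= c1 * r -> 2 <= d * r ->
  (2 * c2) ^ 3 <= d ^ 3 * q ->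
  c1 * (r * q) <= M0 <= c2 * (r * q) -> INR N <= M0 < INR N + 1 ->
  (\sum_v INR (x v) - M0) ^ 2 <= (k * q) ^ 2 -> \sum_v INR (x v) ^ 2 <= k * q ^ 2 ->
  l1_dist K (class_pmf m x) (M_pmf N m) <= d * (160 * k / c1 ^ 2 + 56 * k / c1).
Proof.
move=> m0 xm mq c10 k2 [d0 d1] q1 rk rd qd [M1 M2] [N1 N2] dev sqr.
have [D [le1 le2]] := l1_class_M_pmf K N m0 xm; apply: Rle_trans le1 _.
set T := (\big[addn/0%N]_v x v)%N in le2 *.
rewrite -INR_sum -/T in dev.
have r0 : 0 < r by nra.
have dr0 : 0 < d * r by nra.
have rq0 : 0 < r * q by nra.
have kq0 : 0 < k * q by nra.
have rkq : 4 * (k * q) <= c1 * (r * q) by nra.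
have kq2 : 2 <= k * q by nra.
have [T1 T2] : M0 - k * q <= INR T <= M0 + k * q by split; apply: Rnot_lt_le => h; nra.
have m2 : INR m ^ 2 = q ^ 4 by rewrite mq; ring.
(* As [d r >= 2], the square [(d r + 2)^2] is at most [4 (d r)^2]; the cubic term, divided by [d r],
   adds at most [(d r)^2] since [q] is large. *)
have pairs j : INR j <= 2 * c2 * (r * q) -> mean_load_pairs j m <= 5 * (d * r) ^ 2.
  move=> jle; have := mean_load_pairs_le j m0 dr0; rewrite m2 => le.
  have q4 : 0 < q ^ 4 by apply: pow_lt; lra.
  have cube : INR j ^ 3 / q ^ 4 <= (d * r) ^ 3.
    apply: (Rmult_le_reg_r _ _ _ q4); rewrite /Rdiv Rmult_assoc Rinv_l; last exact: Rgt_not_eq.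
    rewrite Rmult_1_r; apply: (Rle_trans _ ((2 * c2 * (r * q)) ^ 3)).
      by apply: pow_incr; split => //; apply: pos_INR.
    have rq3 : 0 < r ^ 3 * q ^ 3 by apply: Rmult_lt_0_compat; apply: pow_lt; lra.
    rewrite (_ : _ ^ 3 = (2 * c2) ^ 3 * (r ^ 3 * q ^ 3)); last by ring.
    rewrite (_ : _ * q ^ 4 = d ^ 3 * q * (r ^ 3 * q ^ 3)); last by ring.
    by apply: Rmult_le_compat_r; lra.
  apply: (Rmult_le_reg_l _ _ _ dr0); apply: Rle_trans le _.
  have : (d * r + 2) ^ 2 <= 4 * (d * r) ^ 2 by nra.
  by move=> /(Rmult_le_compat_l _ _ _ (Rlt_le _ _ dr0)); lra.
have mean j : INR j <= 2 * c2 * (r * q) -> mean_load j m <= 7 * (d * r).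
  move=> /pairs le; have := mean_load_le j m0 dr0 => le'.
  by apply: (Rmult_le_reg_l _ _ _ dr0); nra.
have T3 : INR T <= 2 * c2 * (r * q) by lra.
have N3 : INR N <= 2 * c2 * (r * q) by lra.
(* Both ball counts are at least [c1 r q / 2] and differ by at most [2 k q]; with mean loads at most
   [7 d r] this gives 28. *)
have diff : Rabs (mean_load T m - mean_load N m) <= 28 * k * d / c1.
  have lo0 : 0 < c1 * (r * q) / 2 by nra.
  have := mean_load_diff m0 lo0 (a := T) (b := N) _ _ (mean T T3) (mean N N3).
  have TN : Rabs (INR T - INR N) <= 2 * (k * q) by apply: Rabs_le; lra.
  move=> /(_ ltac:(lra) ltac:(lra)) le; apply: (Rmult_le_reg_l _ _ _ lo0).
  apply: Rle_trans le _; rewrite (_ : _ / 2 * _ = 2 * (k * q) * (7 * (d * r))); last by field; lra.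
  by apply: Rmult_le_compat_r; lra.
(* Since [T >= (3/4) c1 r q], the product [T (T - 1)] is at least [(c1 r q)^2 / 8], whence 40 as 8
   times 5. *)
have Dle : D <= 40 * k * d ^ 2 / c1 ^ 2.
  have X0 : 0 < (c1 * (r * q)) ^ 2 / 8 by have : 0 < c1 * (r * q); nra.
  apply: (Rmult_le_reg_l _ _ _ X0).
  rewrite (_ : _ / 8 * (_ / _) = k * q ^ 2 * (5 * (d * r) ^ 2)); last by field; lra.
  case: (Rle_dec D 0) => D0.
    apply: (Rle_trans _ 0); first nra.
    by apply: Rmult_le_pos; [nra|have := pow2_ge_0 (d * r); lra].
  apply: (Rle_trans _ (INR T * INR T.-1 * D)).
    apply: Rmult_le_compat_r; first lra.
    have -> : INR T.-1 = INR T - 1.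
      have Tp : (0 < T)%N by rewrite lt0n; apply/eqP => T0; rewrite T0 /= in T1; lra.
      by rewrite -[in RHS](prednK Tp) S_INR; ring.
    nra.
  apply: Rle_trans le2 _; apply: Rmult_le_compat => //; last exact: pairs.
    by apply: Rsum_ge0 => v _; apply: pow2_ge_0.
  exact: ball_mean_ge0.
have d2 : 40 * k * d ^ 2 / c1 ^ 2 <= d * (40 * k / c1 ^ 2).
  rewrite (_ : _ / _ = d * (d * (40 * k / c1 ^ 2))); last by field; lra.
  have : 0 < 40 * k / c1 ^ 2 by apply: Rdiv_lt_0_compat; nra.
  by move=> y0; have := Rmult_lt_0_compat _ _ d0 y0; nra.
rewrite (_ : d * _ = 4 * (d * (40 * k / c1 ^ 2)) + 2 * (28 * k * d / c1)); last by field; lra.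
lra.
Qed.

Lemma nfloor_bounds (x : R) : 0 <= x -> INR (nfloor x) <= x < INR (nfloor x) + 1.
Proof.
move=> x0; have [lo hi] := base_Int_part x.
have z1 : (-1 < Int_part x)%Z by apply: lt_IZR; lra.
have z0 : (0 <= Int_part x)%Z by lia.
by rewrite /nfloor INR_IZR_INZ Z2Nat.id //; lra.
Qed.

Lemma sqrt_INR_unbounded (X : R) :
  exists n0 : nat, forall n : nat, (n0 <= n)%N -> X <= sqrt (INR n).
Proof.
have [n0 H] := INR_unbounded (X ^ 2); exists n0 => n /INR_leq le.
case: (Rle_dec X 0) => X0; first by apply: Rle_trans X0 (sqrt_pos _).
by rewrite -(sqrt_pow2 X); [apply: sqrt_le_1_alt|]; lra.
Qed.

Theorem theorem3 (m : nat -> nat) (P : nat -> nat -> R)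
  (hm : forall B : nat, exists N0 : nat, forall n : nat, (N0 <= n)%nat -> (B <= m n)%nat)
  (hP : forall n : nat, is_prob_on (m n) (P n))
  (hEY : exists c1 c2 : R, 0 < c1 /\ 0 < c2 /\ exists N0 : nat,
           forall n : nat, (N0 <= n)%nat ->
             c1 <= EY n (m n) (P n) <= c2)
  (hVar : exists C : R, exists N0 : nat,
           forall n : nat, (N0 <= n)%nat -> VarY n (m n) (P n) <= C) :
  Un_cv (fun n : nat =>
    let N := nfloor (sqrt (INR (m n) * INR n) * EY n (m n) (P n)) in
    dTV_upto (maxn n N).+1 (omega'_pmf n (m n) (P n)) (M_pmf N (m n))) 0.
Proof.
move=> eps eps0.
have [c1 [c2 [c10 [c20 [n1 Hn1]]]]] := hEY; have [C [n2 Hn2]] := hVar.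
set C' := Rabs C; have C'0 : 0 <= C' := Rabs_pos C.
(* [A / k] is the sum of the bounds [2 C' / k] and [2 (C' + c2^2) / k] for the Chebyshev and Markov
   terms; [k] makes it at most [eps]. *)
pose A := 4 * C' + 2 * c2 ^ 2; have A0 : 0 <= A by rewrite /A; nra.
pose k := 2 + A / eps.
have k2 : 2 <= k.
  by have := Rmult_le_pos _ _ A0 (Rlt_le _ _ (Rinv_0_lt_compat _ eps0)); rewrite /k /Rdiv; lra.
have Ak : A / k <= eps.
  apply: (Rmult_le_reg_r k); first lra.
  rewrite (_ : A / k * k = A); last by field; lra.
  by rewrite (_ : eps * k = 2 * eps + A); [lra|rewrite /k; field; lra].
(* [d * H] bounds the distance on good configurations, and [d] makes it at most [eps / 2]. The total
   [3 eps / 2] is halved in the total variation distance. *)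
pose H := 160 * k / c1 ^ 2 + 56 * k / c1.
have H0 : 0 < H by apply: Rplus_lt_0_compat; apply: Rdiv_lt_0_compat; nra.
pose d := Rmin 1 (eps / (2 * H)).
have e2H : 0 < eps / (2 * H) by apply: Rdiv_lt_0_compat; lra.
have d01 : 0 < d <= 1 by split; [apply: Rmin_glb_lt; lra|apply: Rmin_l].
have dH : d * H <= eps / 2.
  rewrite (_ : eps / 2 = eps / (2 * H) * H); last by field; lra.
  by apply: Rmult_le_compat_r; [lra|apply: Rmin_r].
have d30 : 0 < d ^ 3 by apply: pow_lt; lra.
have [n3 Hn3] := sqrt_INR_unbounded (Rmax (4 * k / c1) (2 / d)).
have [b Hb] := sqrt_INR_unbounded (Rmax 1 ((2 * c2) ^ 3 / d ^ 3)).
have [n4 Hn4] := hm b.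
exists (maxn (maxn n1 n2) (maxn n3 n4)) => n /leP.
rewrite !geq_max => /andP[/andP[/Hn1 [EYlo EYhi] /Hn2 Var] /andP[/Hn3 rge /Hn4 /Hb qge]].
(* The window reaches [maxn n N] and so contains both supports, as [omega' <= n] and
   [max_load <= N]. *)
move=> {Hn1 Hn2 Hn3 Hn4 Hb}; set N := nfloor _; set K := (maxn n N).+1.
set q := sqrt (INR (m n)) in qge; set r := sqrt (INR n) in rge.
have q1 : 1 <= q := Rle_trans _ _ _ (Rmax_l _ _) qge.
have qd : (2 * c2) ^ 3 <= d ^ 3 * q.
  have := Rle_trans _ _ _ (Rmax_r _ _) qge => le.
  by rewrite (_ : (2 * c2) ^ 3 = d ^ 3 * ((2 * c2) ^ 3 / d ^ 3)); [nra|field; lra].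
have rk : 4 * k <= c1 * r.
  have := Rle_trans _ _ _ (Rmax_l _ _) rge => le.
  by rewrite (_ : 4 * k = c1 * (4 * k / c1)); [nra|field; lra].
have rd : 2 <= d * r.
  have := Rle_trans _ _ _ (Rmax_r _ _) rge => le.
  by rewrite (_ : 2 = d * (2 / d)); [nra|field; lra].
have mq : INR (m n) = q ^ 2 by rewrite /q pow2_sqrt //; apply: pos_INR.
have nr : INR n = r ^ 2 by rewrite /r pow2_sqrt //; apply: pos_INR.
have m0 : (0 < m n)%N by rewrite lt0n; apply/eqP => e; rewrite e /= in mq; nra.
have r0 : 0 < r by nra.
have mp := INR_gt0 m0.
have EYE : EY n (m n) (P n) = r / q * EX (m n) (P n) by rewrite /EY sqrt_div_alt.
have VarE : INR n * (EX2 (m n) (P n) - EX (m n) (P n) ^ 2) = q ^ 2 * VarY n (m n) (P n).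
  by rewrite /VarY mq; field; lra.
have EX2E : INR n * EX2 (m n) (P n)
    = q ^ 2 * (VarY n (m n) (P n) + EY n (m n) (P n) ^ 2).
  by rewrite EYE /VarY mq nr; field; lra.
(* The mean total size, equal to [sqrt (m n) * EY] because [EY] is [r / q] times [EX]. *)
pose M0 := INR n * EX (m n) (P n).
have sME : sqrt (INR (m n) * INR n) * EY n (m n) (P n) = M0.
  by rewrite sqrt_mult_alt; [rewrite -/q -/r EYE /M0 nr; field; lra|lra].
have rq0 : 0 < r * q by nra.
have M0E : M0 = EY n (m n) (P n) * (r * q) by rewrite EYE /M0 nr; field; lra.
have M0b : c1 * (r * q) <= M0 <= c2 * (r * q).
  by rewrite M0E; split; apply: Rmult_le_compat_r; lra.
have Nb : INR N <= M0 < INR N + 1.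
  by rewrite /N sME; apply: nfloor_bounds; nra.
have kq0 : 0 < (k * q) ^ 2 by apply: pow_lt; nra.
have kq20 : 0 < k * q ^ 2 by apply: Rmult_lt_0_compat; [lra|apply: pow_lt; lra].
have dH0 : 0 <= d * H by nra.
have close (S : config n (m n)) :
    (\sum_v INR #|S v| - INR n * EX (m n) (P n)) ^ 2 <= (k * q) ^ 2 ->
    \sum_v INR #|S v| ^ 2 <= k * q ^ 2 ->
    l1_dist K (class_pmf (m n) (fun v => #|S v|)) (M_pmf N (m n)) <= d * H.
  move=> dev sqr; apply: (l1_class_M_pmf_le (M0 := M0) (c2 := c2) K m0 _ mq _ k2 d01 q1 rk) => //.
  by move=> v; rewrite (leq_trans (max_card _)) ?card_ord.
have bound := l1_omega'_le m0 (hP n) kq0 kq20 dH0 close.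
have dTV0 : 0 <= l1_dist K (omega'_pmf n (m n) (P n)) (M_pmf N (m n)).
  by apply: Rsum_ge0 => i _; apply: Rabs_pos.
rewrite VarE EX2E in bound.
rewrite /R_dist Rminus_0_r (_ : dTV_upto _ _ _
  = / 2 * l1_dist K (omega'_pmf n (m n) (P n)) (M_pmf N (m n))) //.
rewrite Rabs_pos_eq; last lra.
have VC : VarY n (m n) (P n) <= C' by apply: Rle_trans Var (Rle_abs C).
have t1 : 2 * (q ^ 2 * VarY n (m n) (P n)) / (k * q) ^ 2 <= 2 * C' / k.
  rewrite (_ : _ / _ = 2 * VarY n (m n) (P n) / k * / k); last by field; lra.
  have ik : 0 < / k by apply: Rinv_0_lt_compat; lra.
  have ik1 : / k <= 1 by rewrite -Rinv_1; apply: Rinv_le_contravar; lra.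
  apply: (Rle_trans _ (2 * C' / k * / k)); first by rewrite /Rdiv; nra.
  have y0 : 0 <= 2 * C' / k by rewrite /Rdiv; nra.
  nra.
have t2 : 2 * (q ^ 2 * (VarY n (m n) (P n) + EY n (m n) (P n) ^ 2)) / (k * q ^ 2)
    <= 2 * (C' + c2 ^ 2) / k.
  rewrite (_ : _ / (k * q ^ 2) = 2 * (VarY n (m n) (P n) + EY n (m n) (P n) ^ 2) / k);
    last by field; lra.
  apply: Rmult_le_compat_r; first by apply/Rlt_le/Rinv_0_lt_compat; lra.
  have : EY n (m n) (P n) ^ 2 <= c2 ^ 2 by apply: pow_incr; lra.
  lra.
have AE : A / k = 2 * C' / k + 2 * (C' + c2 ^ 2) / k by rewrite /A; field; lra.
lra.
Qed.
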